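(* Let $X_1,X_2,U_1,U_2$ be real Hilbert spaces, $U=U_1\times U_2$. For $i=1,2$ consider a monotone port-Hamiltonian system $$\dot x_i=-M_i(x_i)+B_iu_i,\qquad y_i=B_i^*x_i,$$ where $M_i:X_i\supseteq D(M_i)\to X_i$ is accretive and $B_i=\begin{bmatrix} B_i^1 & B_i^2 \end{bmatrix}:U_1\times U_2\to X_i$ is linear and bounded, with $u_i=(u_i^1,u_i^2)$, $y_i=(y_i^1,y_i^2)\in U_1\times U_2$. Let $\mathcal F:U_1\to U_1$ be bounded and linear. Then the interconnection $$\begin{bmatrix} u_1^1 \\ u_2^1 \end{bmatrix}=\begin{bmatrix} 0 & \mathcal F \\ -\mathcal F^* & 0 \end{bmatrix}\begin{bmatrix} y_1^1 \\ y_2^1 \end{bmatrix}$$ leads again to a monotone port-Hamiltonian system on $X_1\times X_2$, namely $$\begin{bmatrix} \dot x_1 \\ \dot x_2 \end{bmatrix}=-M(x_1,x_2)+\begin{bmatrix} B_1^2 & 0 \\ 0 & B_2^2 \end{bmatrix}\begin{bmatrix} u_1^2 \\ u_2^2 \end{bmatrix},\qquad\begin{bmatrix} y_1^2 \\ y_2^2 \end{bmatrix}=\begin{bmatrix} (B_1^2)^* & 0 \\ 0 & (B_2^2)^* \end{bmatrix}\begin{bmatrix} x_1 \\ x_2 \end{bmatrix},$$ $$M(x_1,x_2)=\begin{bmatrix} M_1(x_1) \\ M_2(x_2) \end{bmatrix}-\begin{bmatrix} 0 & B_1^1\mathcal F(B_2^1)^* \\ -B_2^1\mathcal F^*(B_1^1)^*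 & 0 \end{bmatrix}\begin{bmatrix} x_1 \\ x_2 \end{bmatrix},\quad D(M)=D(M_1)\times D(M_2).$$ Furthermore, if both systems $(M_1,B_1)$ and $(M_2,B_2)$ are maximally monotone, then the interconnected system is a maximally monotone port-Hamiltonian system. Moreover, if $M_1$ and $M_2$ are strongly accretive at $\overline x_1$ and $\overline x_2$, respectively, then $M$ is strongly accretive at $\overline x=(\overline x_1,\overline x_2)$. Therefore, if $(u_1^2,u_2^2)=0$, then $(x_1(t),x_2(t))\to(\overline x_1,\overline x_2)$ exponentially as $t\to\infty$ for any strong solution of the interconnected system.
   Context: A (not necessarily linear) operator $M:X\supseteq D(M)\to X$ on a real Hilbert space is accretive if $\langle M(x)-M(y),x-y\rangle\ge0$ for all $x,y\in D(M)$; it is m-accretive if in addition $\operatorname{ran}(\lambda I+M)=X$ for some (equivalently all) $\lambda>0$. It is strongly accretive at $\overline x\in D(M)$ if there is $c_M>0$ with $\langle x-\overline x,M(x)-M(\overline x)\rangle\ge c_M\|x-\overline x\|^2$ for all $x\in D(M)$. A monotone port-Hamiltonian system on $X$ with input space $U$ (a real Hilbert space) is a system $\tfrac{\mathrm d}{\mathrm dt}x(t)=-M(x(t))+Bu(t)$, $x(0)=x_0$, $y(t)=B^*x(t)$ with $M$ accretive and $B:U\to X$ linear and bounded; it is called maximally monotone if $M$ is m-accretive. A strong solution on $[0,t_f]$ is a function $x\in C([0,t_f],X)\cap W^{1,1}((0,t_f],X)$, differentiable almost everywhere, attaining the initial value and satisfying the differential equation for almost every $t$; on $[0,\infty)$ this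 is required on every finite interval.
   Formalization: The final exponential convergence claim is stated under the additional assumption M(x̄)=0 (x̄ is an equilibrium of the interconnected system for zero input); without it the claim fails, e.g. M_i=id, B_i=0, F=0, x̄_i=1 on the real line. *)

(* Defs.v *)
From HB Require Import structures.
From mathcomp Require Import all_boot all_order all_algebra.
From mathcomp Require Import ring lra.
From mathcomp Require Import all_classical all_reals all_analysis.

Set Implicit Arguments.
Unset Strict Implicit.
Unset Printing Implicit Defensive.

Import Order.TTheory GRing.Theory Num.Theory.
Import numFieldNormedType.Exports.

Local Open Scope classical_set_scope.
Local Open Scope ring_scope.

(** * Real Hilbert spaces *)

HB.mixin Record NormedModule_hasInner (R : realType) V & NormedModule R V := {
  inner : V -> V -> R;
  innerC : forall x y, inner x y = inner y x;
  innerDl : forall x y z, inner (x + y) z = inner x z + inner y z;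
  innerZl : forall a x y, inner (a *: x) y = a * inner x y;
  innerxx : forall x, inner x x = `|x| ^+ 2
}.

#[short(type="hilbertType")]
HB.structure Definition Hilbert (R : realType) :=
  {V of CompleteNormedModule R V & NormedModule_hasInner R V}.

(** * Hilbert product

  The library norms [X * Y] by the maximum of the norms, which does not come
  from an inner product. [hprod X Y] is the same module with inner product
  <x1, y1> + <x2, y2>; its topology is the product topology. *)

Definition hprod (X Y : Type) : Type := (X * Y)%type.

Section hprod_lmodule.
Variables (R : realType) (X Y : normedModType R).

HB.instance Definition _ := GRing.Lmodule.copy (hprod X Y) (X * Y)%type.

Definition hprod_norm (x : hprod X Y) : R :=
  Num.sqrt (`|x.1| ^+ 2 + `|x.2| ^+ 2).

Lemma hprod_norm_sqr x : hprod_norm x ^+ 2 = `|x.1| ^+ 2 + `|x.2| ^+ 2.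
Proof. by rewrite sqr_sqrtr// addr_ge0// sqr_ge0. Qed.

Lemma hprod_norm_ge0 x : 0 <= hprod_norm x.
Proof. exact: sqrtr_ge0. Qed.

Lemma hprod_ler_normD x y : hprod_norm (x + y) <= hprod_norm x + hprod_norm y.
Proof.
have a0 := normr_ge0 x.1; have b0 := normr_ge0 x.2.
have c0 := normr_ge0 y.1; have d0 := normr_ge0 y.2.
have xE := hprod_norm_sqr x; have yE := hprod_norm_sqr y.
have x0 := hprod_norm_ge0 x; have y0 := hprod_norm_ge0 y.
rewrite -(ler_pXn2r (_ : (0 < 2)%N))// ?nnegrE ?addr_ge0//; last first.
  exact: hprod_norm_ge0.
rewrite hprod_norm_sqr sqrrD xE yE.
have e1 : `|(x + y).1| ^+ 2 <= (`|x.1| + `|y.1|) ^+ 2.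
  by rewrite ler_pXn2r ?nnegrE ?addr_ge0//; exact: ler_normD.
have e2 : `|(x + y).2| ^+ 2 <= (`|x.2| + `|y.2|) ^+ 2.
  by rewrite ler_pXn2r ?nnegrE ?addr_ge0//; exact: ler_normD.
apply: (le_trans (lerD e1 e2)); rewrite !sqrrD.
have cs : `|x.1| * `|y.1| + `|x.2| * `|y.2| <= hprod_norm x * hprod_norm y.
  rewrite -(ler_pXn2r (_ : (0 < 2)%N))// ?nnegrE ?addr_ge0// ?mulr_ge0//.
  rewrite exprMn xE yE -subr_ge0.
  rewrite (_ : _ - _ = (`|x.1| * `|y.2| - `|x.2| * `|y.1|) ^+ 2).
    exact: sqr_ge0.
  by rewrite sqrrD !sqrrB !exprMn !mulrDl !mulrDr; ring.
by lra.
Qed.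

Lemma hprod_normrZ (l : R) x : hprod_norm (l *: x) = `|l| * hprod_norm x.
Proof.
rewrite /hprod_norm /= !normrZ !exprMn -mulrDr sqrtrM ?sqr_ge0//.
by rewrite sqrtr_sqr normr_id.
Qed.

Lemma hprod_normr0_eq0 x : hprod_norm x = 0 -> x = 0.
Proof.
move=> x0; have := hprod_norm_sqr x; rewrite x0 expr0n/= => /esym/eqP.
rewrite paddr_eq0 ?sqr_ge0// !sqrf_eq0 !normr_eq0 => /andP[/eqP h1 /eqP h2].
by case: x h1 h2 {x0} => a b /= -> ->.
Qed.

HB.instance Definition _ := Lmodule_isNormed.Build R (hprod X Y)
  hprod_ler_normD hprod_normrZ hprod_normr0_eq0.

Lemma hprod_normE (x : hprod X Y) :
  `|x| = Num.sqrt (`|x.1| ^+ 2 + `|x.2| ^+ 2).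
Proof. by []. Qed.

End hprod_lmodule.

Section hprod_complete.
Variables (R : realType) (X Y : completeNormedModType R).
Implicit Types x : hprod X Y.

Lemma hprod_norm_fst x : `|x.1| <= `|x|.
Proof.
rewrite hprod_normE -[leLHS]ger0_norm// -sqrtr_sqr.
by rewrite ler_sqrt ?lerDl ?addr_ge0 ?sqr_ge0.
Qed.

Lemma hprod_norm_snd x : `|x.2| <= `|x|.
Proof.
rewrite hprod_normE -[leLHS]ger0_norm// -sqrtr_sqr.
by rewrite ler_sqrt ?lerDr ?addr_ge0 ?sqr_ge0.
Qed.

Lemma hprod_norm_le x : `|x| <= `|x.1| + `|x.2|.
Proof.
rewrite hprod_normE -[leRHS]ger0_norm ?addr_ge0// -sqrtr_sqr.
rewrite ler_sqrt ?sqr_ge0// sqrrD -subr_ge0.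
rewrite (_ : _ - _ = (`|x.1| * `|x.2|) *+ 2); last by ring.
by rewrite mulrn_wge0// mulr_ge0.
Qed.

Lemma hprod_complete (G : set_system (hprod X Y)) :
  ProperFilter G -> cauchy G -> cvg G.
Proof.
move=> GG /cauchyP Gc.
have c1 : cvg (fmap (fun x : hprod X Y => x.1) G).
  apply: cauchy_cvg; apply/cauchyP => e e0; have [x Gx] := Gc e e0.
  exists x.1; rewrite /nbhs/=; apply: filterS Gx => y.
  rewrite -!ball_normE /=; apply: le_lt_trans; exact: (hprod_norm_fst (x - y)).
have c2 : cvg (fmap (fun x : hprod X Y => x.2) G).
  apply: cauchy_cvg; apply/cauchyP => e e0; have [x Gx] := Gc e e0.
  exists x.2; rewrite /nbhs/=; apply: filterS Gx => y.
  rewrite -!ball_normE /=; apply: le_lt_trans; exact: (hprod_norm_snd (x - y)).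
apply/cvg_ex; move/cvg_ex : c1 => [a Ga]; move/cvg_ex : c2 => [b Gb].
exists ((a, b) : hprod X Y); apply/cvgrPdist_lt => e e0.
have e20 : 0 < e / 2 by rewrite divr_gt0.
move/cvgrPdist_lt : Ga => /(_ _ e20) Ga; move/cvgrPdist_lt : Gb => /(_ _ e20) Gb.
apply: filterS2 Ga Gb => y ya yb.
rewrite (le_lt_trans (hprod_norm_le _))//= [ltRHS](splitr e).
exact: ltrD.
Qed.

HB.instance Definition _ :=
  Uniform_isComplete.Build (hprod X Y) hprod_complete.

End hprod_complete.

Section hprod_hilbert.
Variables (R : realType) (X Y : hilbertType R).
Implicit Types x y z : hprod X Y.

Definition hprod_inner x y : R := inner x.1 y.1 + inner x.2 y.2.

Lemma hprod_innerC x y : hprod_inner x y = hprod_inner y x.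
Proof. by rewrite /hprod_inner innerC [X in _ + X]innerC. Qed.

Lemma hprod_innerDl x y z :
  hprod_inner (x + y) z = hprod_inner x z + hprod_inner y z.
Proof. by rewrite /hprod_inner !innerDl addrACA. Qed.

Lemma hprod_innerZl a x y : hprod_inner (a *: x) y = a * hprod_inner x y.
Proof. by rewrite /hprod_inner !innerZl mulrDr. Qed.

Lemma hprod_innerxx x : hprod_inner x x = `|x| ^+ 2.
Proof. by rewrite /hprod_inner !innerxx -hprod_norm_sqr. Qed.

HB.instance Definition _ := NormedModule_hasInner.Build R (hprod X Y)
  hprod_innerC hprod_innerDl hprod_innerZl hprod_innerxx.

End hprod_hilbert.

(** * Operators *)

(** A (possibly nonlinear) operator [M : X >= D(M) -> X]; the values of [opmap]
  outside [opdom] are irrelevant. *)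
Record operator (X : Type) := Operator { opdom : set X; opmap :> X -> X }.

Section operators.
Variables (R : realType) (X U : hilbertType R).
Implicit Types M : operator X.

Definition accretive M := forall x y, opdom M x -> opdom M y ->
  0 <= inner (M x - M y) (x - y).

Definition m_accretive M := accretive M /\
  exists2 l : R, 0 < l &
    forall z, exists2 x, opdom M x & l *: x + M x = z.

Definition strongly_accretive_at M (xbar : X) := opdom M xbar /\
  exists2 c : R, 0 < c & forall x, opdom M x ->
    c * `|x - xbar| ^+ 2 <= inner (x - xbar) (M x - M xbar).

Definition bounded_linear (B : U -> X) := linear B /\
  exists k : R, forall u, `|B u| <= k * `|u|.

(** For bounded linear [B], [adjoint B x] is the vector given by the Riesz
  representation of [u |-> <B u, x>]. *)
Definition adjoint (B : U -> X) (x : X) : U :=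
  xget 0 [set w | forall u, inner (B u) x = inner u w].

End operators.

(** * Bochner integral and Sobolev functions of one real variable *)

Section bochner.
Variables (R : realType) (X : hilbertType R).
Local Notation mu := (@lebesgue_measure R).

(** [s] stands for the step function [sum_(p in s) 1_{p.1} p.2] on [D]. *)
Definition step_on (D : set R) (s : seq (set R * X)) := forall p, p \in s ->
  [/\ measurable p.1, p.1 `<=` D & (mu p.1 < +oo)%E].

Definition step_fun (s : seq (set R * X)) (t : R) : X :=
  \sum_(p <- s) (\1_(p.1) t : R) *: p.2.

Definition step_int (s : seq (set R * X)) : X :=
  \sum_(p <- s) fine (mu p.1) *: p.2.

(** [w] is the Bochner integral of [f] over [D]. The norm [`|f - s_n|] is only
  a.e. equal to a Borel function; this is harmless because the integral of a
  nonnegative function is defined as a supremum over simple functions. *)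
Definition is_bochner (D : set R) (f : R -> X) (w : X) :=
  exists s : nat -> seq (set R * X), [/\
    forall n, step_on D (s n),
    {ae mu, forall t, D t -> step_fun (s n) t @[n --> \oo] --> f t},
    (\int[mu]_(t in D) (`|f t - step_fun (s n) t|%:E))%E @[n --> \oo] --> 0%E &
    step_int (s n) @[n --> \oo] --> w].

Definition bochner_integrable (D : set R) (f : R -> X) :=
  exists w, is_bochner D f w.

(** Weak derivatives on an interval are tested against [C^1] functions with
  compact support in [(a, b)]. *)
Definition test_function (a b : R) (phi : R -> R) := [/\
  forall t, derivable phi t 1, continuous (derive1 phi) &
  exists c d, [/\ a < c, d < b & forall t, t \notin `[c, d] -> phi t = 0]].

Definition weak_derivative (a b : R) (x v : R -> X) :=
  forall phi, test_function a b phi -> exists2 w,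
    is_bochner `]a, b[ (fun t => derive1 phi t *: x t) w &
    is_bochner `]a, b[ (fun t => phi t *: v t) (- w).

Definition W11 (a b : R) (x : R -> X) := bochner_integrable `]a, b[ x /\
  exists2 v, bochner_integrable `]a, b[ v & weak_derivative a b x v.

(** The space [W^{1,1}((0, T], X)]: integrable on [(0, T)], with weak
  derivative integrable on [(d, T)] for every [0 < d < T]. *)
Definition W11_left_open (T : R) (x : R -> X) :=
  bochner_integrable `]0, T[ x /\ forall d, 0 < d < T -> W11 d T x.

End bochner.

(** * Monotone port-Hamiltonian systems *)

(** The system x' = - M x + B u, y = B^* x. *)
Record system (X U : Type) := System { sysM : operator X; sysB : U -> X }.

Section systems.
Variables (R : realType) (X U : hilbertType R).
Implicit Types (S : system X U) (u y : R -> U) (x : R -> X) (T : R).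

Definition monotone_pHs S := accretive (sysM S) /\ bounded_linear (sysB S).

Definition maximally_monotone_pHs S :=
  monotone_pHs S /\ m_accretive (sysM S).

Definition strong_solution S u (x0 : X) T x := [/\
  {within `[0, T], continuous x}, W11_left_open T x, x 0 = x0 &
  {ae (@lebesgue_measure R), forall t, t \in `]0, T[ ->
    opdom (sysM S) (x t) /\
    is_derive t (1 : R) x (- sysM S (x t) + sysB S (u t))}].

Definition strong_solution_infty S u (x0 : X) x :=
  forall T, 0 < T -> strong_solution S u x0 T x.

Definition trajectory S T (x0 : X) x u y := strong_solution S u x0 T x /\
  forall t, t \in `[0, T] -> y t = adjoint (sysB S) (x t).

Definition trajectory_infty S (x0 : X) x u y :=
  forall T, 0 < T -> trajectory S T x0 x u y.

End systems.

(** * Power-preserving interconnection *)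

Section interconnection.
Variables (R : realType) (X1 X2 U1 U2 : hilbertType R).

Definition block1 (X : hilbertType R) (B : hprod U1 U2 -> X) (u : U1) : X :=
  B (u, 0).

Definition block2 (X : hilbertType R) (B : hprod U1 U2 -> X) (u : U2) : X :=
  B (0, u).

Variables (S1 : system X1 (hprod U1 U2)) (S2 : system X2 (hprod U1 U2)).
Variable F : U1 -> U1.

(** The interconnection law imposed on the inputs and outputs of [S1], [S2]. *)
Definition interconnected (u1 y1 u2 y2 : U1) :=
  u1 = F y2 /\ u2 = - adjoint F y1.

Definition interconnectM : operator (hprod X1 X2) := Operator
  [set x : hprod X1 X2 | opdom (sysM S1) x.1 /\ opdom (sysM S2) x.2]
  (fun x : hprod X1 X2 =>
    (sysM S1 x.1 - block1 (sysB S1) (F (adjoint (block1 (sysB S2)) x.2)),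
     sysM S2 x.2
       + block1 (sysB S2) (adjoint F (adjoint (block1 (sysB S1)) x.1)))).

Definition interconnectB (u : hprod U2 U2) : hprod X1 X2 :=
  (block2 (sysB S1) u.1, block2 (sysB S2) u.2).

Definition interconnection : system (hprod X1 X2) (hprod U2 U2) :=
  System interconnectM interconnectB.

End interconnection.

(* Main.v *)
(* The coupling operator is skew: <B1 F B2^* x2, x1> = <x2, B2 F^* B1^* x1>, so
   it drops out of <M x - M y, x - y> and (strong) accretivity of M is that of
   M1 and M2. For the range condition, lambda + M is a perturbation of
   lambda + diag(M1, M2) by a Lipschitz map; for lambda larger than the Lipschitz
   constant the resolvent turns it into a contraction. For the decay, a strong
   solution satisfies (e^(2 c t) |x t - xbar|^2)' <= 0 almost everywhere; this
   gives monotonicity because the W^{1,1} bound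
   |x t - x s| <= int_s^t g with g integrable makes the function absolutely
   continuous. *)
From HB Require Import structures.
Require Import Defs.
From mathcomp Require Import all_boot all_order all_algebra.
From mathcomp Require Import ring lra.
From mathcomp Require Import all_classical all_reals all_analysis.
From mathcomp Require Import measurable_realfun.

Set Implicit Arguments.
Unset Strict Implicit.
Unset Printing Implicit Defensive.

Import Order.TTheory GRing.Theory Num.Theory.
Import numFieldNormedType.Exports.

Local Open Scope classical_set_scope.
Local Open Scope ring_scope.

(** * Hilbert spaces, Riesz representation and adjoints *)

(** Each of [M1] and [M2] has its range condition at one unspecified parameter, possibly below the
    Lipschitz constant of the coupling. Both must first be moved to a common large parameter; the
    same fixed-point argument does this, repeated in steps of a factor below 2. In the decay part
    the weak derivative is never identified with the pointwise one: the pointwise derivative comes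
    from the differential equation, and the weak one serves only to bound increments. Without such a
    bound an almost everywhere sign of the derivative says nothing about monotonicity, as the Cantor
    function shows. The bound lives on []d, T[] with [d > 0], so decay is proved from positive times
    and extended to 0 by continuity. The norm under the integral in the definition of the Bochner
    integral need not be Borel measurable, so its integral is monotone but not readily additive;
    estimates pass through measurable functions that are almost everywhere equal to it or below
    it. *)

Section inner_theory.
Variables (R : realType) (X : hilbertType R).
Implicit Types (x y z : X) (a : R).

Lemma innerDr x y z : inner z (x + y) = inner z x + inner z y.
Proof. by rewrite !(innerC z) innerDl. Qed.

Lemma innerZr a x y : inner x (a *: y) = a * inner x y.
Proof. by rewrite !(innerC x) innerZl. Qed.

Lemma inner0l x : inner 0 x = 0.
Proof. by rewrite -(scale0r 0) innerZl mul0r. Qed.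

Lemma inner0r x : inner x 0 = 0.
Proof. by rewrite innerC inner0l. Qed.

Lemma innerNl x y : inner (- x) y = - inner x y.
Proof. by rewrite -scaleN1r innerZl mulN1r. Qed.

Lemma innerNr x y : inner x (- y) = - inner x y.
Proof. by rewrite innerC innerNl innerC. Qed.

Lemma innerBl x y z : inner (x - y) z = inner x z - inner y z.
Proof. by rewrite innerDl innerNl. Qed.

Lemma innerBr x y z : inner z (x - y) = inner z x - inner z y.
Proof. by rewrite innerDr innerNr. Qed.

Lemma normD_sqr x y : `|x + y| ^+ 2 = `|x| ^+ 2 + 2 * inner x y + `|y| ^+ 2.
Proof. by rewrite -!innerxx innerDl !innerDr (innerC y x); ring. Qed.

Lemma normB_sqr x y : `|x - y| ^+ 2 = `|x| ^+ 2 - 2 * inner x y + `|y| ^+ 2.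
Proof. by rewrite normD_sqr innerNr normrN mulrN. Qed.

Lemma inner_polar x y : inner x y = (`|x + y| ^+ 2 - `|x - y| ^+ 2) / 4.
Proof. by rewrite normD_sqr normB_sqr; field. Qed.

(** Expand the squared norm of |y| x - |x| y, which is nonnegative, and cancel the factor |x|
    |y|. *)
Lemma inner_le_norm x y : inner x y <= `|x| * `|y|.
Proof.
have [->|x0] := eqVneq x 0; first by rewrite inner0l normr0 mul0r.
have [->|y0] := eqVneq y 0; first by rewrite inner0r normr0 mulr0.
have xy0 : 0 < `|x| * `|y| by rewrite mulr_gt0 ?normr_gt0.
have := sqr_ge0 `| `|y| *: x - `|x| *: y|.
rewrite normB_sqr innerZl innerZr !normrZ !normr_id => h.
rewrite -(ler_pM2l xy0) -subr_ge0.
rewrite (_ : _ - _ = ((`|y| * `|x|) ^+ 2 - 2 * (`|y| * (`|x| * inner x y)) +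
  (`|x| * `|y|) ^+ 2) / 2); last by field.
by rewrite divr_ge0.
Qed.

Lemma normr_inner_le x y : `|inner x y| <= `|x| * `|y|.
Proof.
rewrite ler_norml inner_le_norm andbT lerNl -innerNl.
by rewrite (le_trans (inner_le_norm _ _))// normrN.
Qed.

Lemma inner_eq x y : (forall u, inner u x = inner u y) -> x = y.
Proof.
move=> h; apply/eqP; rewrite -subr_eq0 -normr_eq0 -sqrf_eq0 -innerxx.
by rewrite innerBr h subrr.
Qed.

Lemma cvg_inner (T : Type) (G : set_system T) {FG : Filter G} (f g : T -> X) x y :
  f @ G --> x -> g @ G --> y -> inner (f t) (g t) @[t --> G] --> inner x y.
Proof.
move=> fx gy; under eq_fun do rewrite inner_polar; rewrite inner_polar.
apply: cvgM; last exact: cvg_cst.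
by apply: cvgB; apply: cvgM; apply: cvg_norm;
  first [exact: cvgD|exact: cvgB].
Qed.

End inner_theory.

Lemma bounded_linear_pos (R : realType) (U V : hilbertType R) (B : U -> V) :
  bounded_linear B -> exists2 k, 0 < k & forall u, `|B u| <= k * `|u|.
Proof.
move=> [_ [k kB]]; exists (Num.max k 1); first by rewrite lt_max ltr01 orbT.
by move=> u; rewrite (le_trans (kB u))// ler_wpM2r// le_max lexx.
Qed.

Lemma linearFE (R : pzRingType) (U V : lmodType R) (B : U -> V) : linear B ->
  [/\ B 0 = 0, {morph B : x y / x + y}, {morph B : x y / x - y},
   {morph B : x / - x} & forall a, {morph B : x / a *: x}].
Proof.
move=> lB.
pose B' := HB.pack B (GRing.isLinear.Build _ _ _ _ _ lB) : {linear U -> V}.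
split; [exact: (linear0 B')|exact: (linearD B')|exact: (linearB B')|
        exact: (linearN B')|move=> a; exact: (linearZ_LR B')].
Qed.

Lemma bounded_linear_cvg (R : realType) (U V : hilbertType R) (B : U -> V)
    (T : Type) (G : set_system T) {FG : Filter G} (f : T -> U) x :
  bounded_linear B -> f @ G --> x -> B (f t) @[t --> G] --> B x.
Proof.
move=> bB /cvgrPdist_lt fx; have [k k0 kB] := bounded_linear_pos bB.
have [_ _ BB _ _] := linearFE bB.1.
apply/cvgrPdist_lt => e e0.
near=> t; rewrite -BB (le_lt_trans (kB _))// mulrC -ltr_pdivlMr//.
by near: t; apply: fx; exact: divr_gt0.
Unshelve. all: by end_near. Qed.

(** * Riesz representation of bounded functionals *)

Section riesz.
Variables (R : realType) (X : hilbertType R) (f : X -> R).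
Hypothesis lf : linear (f : X -> R^o).
Variable k : R.
Hypothesis fk : forall x, `|f x| <= k * `|x|.

(* The representative is the minimiser of [J]: a minimising sequence is Cauchy
   by the parallelogram identity. *)
Let J x := `|x| ^+ 2 - 2 * f x.

Let fD x y : f (x + y) = f x + f y.
Proof. by have [_ + _ _ _] := linearFE lf; apply. Qed.

Let fZ a x : f (a *: x) = a * f x.
Proof. by have [_ _ _ _ +] := linearFE lf; apply. Qed.

Let fB x y : f (x - y) = f x - f y.
Proof. by have [_ _ + _ _] := linearFE lf; apply. Qed.

Let m := inf (range J).

Let hasinfJ : has_inf (range J).
Proof.
split; first by exists (J 0), 0.
(* Completing the square: |x|^2 - 2 k |x| >= - k^2. *)
exists (- k ^+ 2) => _ [x _ <-]; rewrite /J.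
have := fk x; have := ler_norm (f x).
by have := sqr_ge0 (`|x| - k); rewrite sqrrB; lra.
Qed.

Let m_le x : m <= J x.
Proof. by apply: ge_inf; [exact: hasinfJ.2|exists x]. Qed.

(** |x - y|^2 equals 2 J x + 2 J y - 4 J ((x + y) / 2), and the midpoint value is at least [m]. *)
Let parallelogram x y : `|x - y| ^+ 2 <= 2 * (J x - m) + 2 * (J y - m).
Proof.
have := m_le (2^-1 *: (x + y)).
rewrite /J fZ fD normrZ exprMn normD_sqr normB_sqr ger0_norm//.
by rewrite expr2; lra.
Qed.

Let riesz_min : exists w, J w = m.
Proof.
have /choice[u uP] : forall n : nat, exists x, J x < m + n.+1%:R^-1.
  move=> n; have n0 : 0 < n.+1%:R^-1 :> R by rewrite invr_gt0 ltr0n.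
  by have [_ [x _ <-] ?] := inf_adherent n0 hasinfJ; exists x.
have Jm : J (u n) @[n --> \oo] --> m.
  apply: (@squeeze_cvgr _ _ _ _ (cst m) (fun n => m + n.+1%:R^-1)).
  - by near=> n; rewrite m_le/= ltW.
  - exact: cvg_cst.
  - by rewrite -[X in _ --> X]addr0; apply: cvgD; [exact: cvg_cst|exact: cvg_harmonic].
have : cvgn u.
  apply: cauchy_cvg; apply/cauchy_ballP => e e0.
  (* Two values of [J] within e^2 / 4 of [m] force a squared distance below e^2. *)
  have e4 : 0 < e ^+ 2 / 4 by rewrite divr_gt0// exprn_gt0.
  move/cvgrPdist_lt : Jm => /(_ _ e4)[N _ NP].
  exists (u @` [set n | (N <= n)%N], u @` [set n | (N <= n)%N]) => /=.
    by split; exists N => // n /= ?; exists n.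
  move=> [_ _] [/= [n Nn <-] [p Np <-]]; rewrite -ball_normE/=.
  rewrite -(ltr_pXn2r (_ : (0 < 2)%N))// ?nnegrE// ?(ltW e0)//.
  apply: le_lt_trans (parallelogram _ _) _.
  have := NP _ Nn; have := NP _ Np => /=.
  by rewrite !(distrC m) !ger0_norm ?subr_ge0//; lra.
move=> /cvg_ex[w uw]; exists w.
have Jw : J (u n) @[n --> \oo] --> J w.
  apply: cvgB; first by apply: cvgM; exact: cvg_norm.
  apply: cvgM; first exact: cvg_cst.
  apply/cvgrPdist_lt => e e0.
  have k1 : 0 < Num.max k 1 by rewrite lt_max ltr01 orbT.
  near=> n; rewrite -fB (@le_lt_trans _ _ (Num.max k 1 * `|w - u n|))//.
    by rewrite (le_trans (fk _))// ler_wpM2r// le_max lexx.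
  rewrite mulrC -ltr_pdivlMr//; near: n.
  by move/cvgrPdist_lt : uw; apply; exact: divr_gt0.
exact: (cvg_unique _ Jw Jm).
Unshelve. all: by end_near. Qed.

Lemma riesz : exists w, forall u, f u = inner u w.
Proof.
have [w wP] := riesz_min; exists w => u.
apply/eqP; rewrite -subr_eq0; set d := _ - _.
have key t : 0 <= t ^+ 2 * `|u| ^+ 2 - 2 * t * d.
  have := m_le (w + t *: u); rewrite -wP /J fD fZ normD_sqr innerZr normrZ.
  by rewrite exprMn real_normK ?num_real// /d (innerC u w); lra.
have [u0|u0] := eqVneq `|u| 0.
  by have := key 1; have := key (-1); rewrite u0; lra.
have uu : 0 < `|u| ^+ 2 by rewrite exprn_gt0// lt_neqAle eq_sym u0 normr_ge0.
(* This parameter minimises the quadratic in [key]; its minimum - d^2 / |u|^2 must be nonnegative,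
   so [d] vanishes. *)
have := key (d / `|u| ^+ 2).
rewrite (_ : _ - _ = - (d ^+ 2 / `|u| ^+ 2)); last by field.
rewrite oppr_ge0 pmulr_lle0 ?invr_gt0// => d0.
by rewrite -sqrf_eq0 eq_le d0 sqr_ge0.
Qed.

End riesz.

Section adjoint_theory.
Variables (R : realType) (U X : hilbertType R) (B : U -> X).
Hypothesis bB : bounded_linear B.

Lemma adjointP u x : inner (B u) x = inner u (adjoint B x).
Proof.
move: u; rewrite /adjoint; case: xgetP => [w _ //|none].
have [w wP] : exists w, forall u, inner (B u) x = inner u w.
  have [k k0 kB] := bounded_linear_pos bB.
  apply: (@riesz _ _ _ _ (k * `|x|)).
    by move=> a u v; rewrite bB.1 innerDl innerZl.
  move=> u; rewrite (le_trans (normr_inner_le _ _))// mulrAC.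
  by rewrite ler_wpM2r.
by have := none w wP.
Qed.

Lemma adjoint_unique x w : (forall u, inner (B u) x = inner u w) ->
  adjoint B x = w.
Proof. by move=> h; apply: inner_eq => u; rewrite -adjointP h. Qed.

(** Linearity follows from uniqueness of the representing vector, the bound from |B^* x|^2 = <B B^*
    x, x> <= k |B^* x| |x|. *)
Lemma adjoint_bounded_linear : bounded_linear (adjoint B).
Proof.
split.
  move=> a x y; apply: adjoint_unique => u.
  by rewrite !innerDr !innerZr !adjointP.
have [k k0 kB] := bounded_linear_pos bB.
exists k => x; have [->|x0] := eqVneq (adjoint B x) 0.
  by rewrite normr0 mulr_ge0// ltW.
have ax0 : 0 < `|adjoint B x| by rewrite normr_gt0.
rewrite -(ler_pM2l ax0) -expr2 -innerxx -adjointP.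
rewrite (le_trans (inner_le_norm _ _))// mulrA ler_wpM2r//.
by rewrite mulrC kB.
Qed.

End adjoint_theory.

(** * Ranges of accretive operators *)

Section accretive_theory.
Variables (R : realType) (X : hilbertType R) (M : operator X).
Hypothesis aM : accretive M.

Definition range_full (l : R) :=
  forall z, exists2 x, opdom M x & l *: x + M x = z.

(** Pairing with [x - y] makes the [M] part nonnegative. Hence the resolvent is single-valued and
    Lipschitz with constant [1 / l]. *)
Lemma accretive_expansive l x y : 0 < l -> opdom M x -> opdom M y ->
  l * `|x - y| <= `|(l *: x + M x) - (l *: y + M y)|.
Proof.
move=> l0 Dx Dy; have [->|xy] := eqVneq x y.
  by rewrite !subrr normr0 mulr0.
have d0 : 0 < `|x - y| by rewrite normr_gt0 subr_eq0.
rewrite -(ler_pM2r d0); apply: le_trans (inner_le_norm _ _).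
rewrite opprD addrACA -scalerBr innerDl innerZl innerxx expr2 mulrA.
by rewrite lerDl aM.
Qed.

(** Solutions are fixed points of the resolvent applied to [z + G x], a contraction with constant
    [k / l]. *)
Lemma range_full_perturb l k (G : X -> X) : 0 < l -> 0 <= k < l ->
  (forall x y, `|G x - G y| <= k * `|x - y|) -> range_full l ->
  forall z, exists2 x, opdom M x & l *: x + M x = z + G x.
Proof.
move=> l0 /andP[k0 kl] Gk Ml z.
have /choice[J JP] : forall y, exists x, opdom M x /\ l *: x + M x = y.
  by move=> y; have [x ? ?] := Ml y; exists x.
pose f x := J (z + G x).
have fcontr x y : `|f x - f y| <= k / l * `|x - y|.
  have [D1 E1] := JP (z + G x); have [D2 E2] := JP (z + G y).
  have := accretive_expansive l0 D1 D2.
  rewrite E1 E2 opprD addrACA subrr add0r => /le_trans/(_ (Gk _ _)).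
  by rewrite -/(f x) -/(f y) mulrAC ler_pdivlMr// mulrC.
have kl0 : 0 <= k / l by rewrite divr_ge0// ltW.
pose fT := HB.pack f (@isFun.Build _ _ setT setT f (fun _ _ => I)) :
  {fun [set: X] >-> [set: X]}.
have : is_contraction fT.
  exists (NngNum kl0); split => /=; first by rewrite ltr_pdivrMr// mul1r.
  by move=> [x y] _ /=; exact: fcontr.
move=> /banach_fixed_point/(_ closedT)[]; [by exists 0|move=> x _ xE].
have [D1 E1] := JP (z + G x).
exists x; first by rewrite xE.
by rewrite -[in RHS]E1 -[J _]/(fT x) -xE.
Qed.

(** Write l' x + M x = z as l x + M x = z + (l - l') x. The perturbation has Lipschitz constant |l -
    l'|, which is below [l] exactly when 0 < l' < 2 l. *)
Lemma range_full_lt2 l l' : 0 < l' < 2 * l -> range_full l -> range_full l'.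
Proof.
move=> /andP[l'0 l'2] Ml z.
have l0 : 0 < l by lra.
have ll : 0 <= `|l - l'| < l.
  by rewrite normr_ge0/= ltr_norml; apply/andP; split; lra.
have lip (x y : X) : `|(l - l') *: x - (l - l') *: y| <= `|l - l'| * `|x - y|.
  by rewrite -scalerBr normrZ.
have [x Dx] := range_full_perturb l0 ll lip Ml z.
rewrite scalerBl => xE; exists x => //.
by rewrite -[z](addrK (l *: x - l' *: x)) -xE opprB addrAC subrKC.
Qed.

(** Growth by 3 / 2, an admissible factor below 2, eventually passes [l']; from there a single step
    leads down to [l'], however small it is. *)
Lemma range_full_all l l' : 0 < l -> 0 < l' -> range_full l -> range_full l'.
Proof.
move=> l0 l'0 Ml.
have Mn n : range_full ((3 / 2) ^+ n * l).
  elim: n => [|n ih]; first by rewrite expr0 mul1r.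
  apply: range_full_lt2 ih; rewrite exprS.
  have : 0 < (3 / 2) ^+ n * l :> R by rewrite mulr_gt0// exprn_gt0.
  by rewrite -mulrA; move: (_ * l) => a a0; lra.
have [n nl] : exists n, l' < (3 / 2) ^+ n * l.
  (* Bernoulli's inequality makes the growth explicit: an exponent above 2 l' / l suffices. *)
  have bern n : 1 + n%:R / 2 <= (3 / 2 : R) ^+ n.
    elim: n => [|n ih]; first by rewrite mul0r addr0.
    by rewrite exprS -natr1; have := ler0n R n; lra.
  pose n := Num.trunc (2 * l' / l).
  exists n.+1; rewrite -ltr_pdivrMr//; apply: lt_le_trans (bern _).
  have : 2 * l' / l < n.+1%:R by rewrite truncnS_gt.
  by rewrite -mulrA; lra.
apply: range_full_lt2 (Mn n); rewrite l'0/=; lra.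
Qed.

End accretive_theory.

(** * Step functions and the Bochner integral *)

Lemma lebesgue_ae_filter (R : realType) :
  Filter (almost_everywhere (@lebesgue_measure R)).
Proof. exact: ae_filter_ringOfSetsType. Qed.

(* The library hint fails on the Borel structure that [R] carries here. *)
#[local] Hint Extern 0 (Filter (almost_everywhere _)) =>
  (exact: lebesgue_ae_filter) : typeclass_instances.
#[local] Hint Extern 0 (Filter (nbhs (almost_everywhere _))) =>
  (exact: lebesgue_ae_filter) : typeclass_instances.

Section lower_integral.
Local Open Scope ereal_scope.
Context d (T : measurableType d) (R : realType).
Variable mu : {measure set T -> \bar R}.
Import HBNNSimple.

(* No measurability: the library integral of a nonnegative function is the
   supremum over the simple functions below it. *)
Lemma ge0_ae_le_lower_integral (D : set T) (f g : T -> \bar R) :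
  measurable D -> (forall x, D x -> 0 <= f x) -> (forall x, D x -> 0 <= g x) ->
  {ae mu, forall x, D x -> f x <= g x} ->
  \int[mu]_(x in D) f x <= \int[mu]_(x in D) g x.
Proof.
move=> mD f0 g0 [N [mN N0 fgN]]; rewrite !ge0_integralE//.
apply: ge_ereal_sup => _ [h hf <-].
(* Cutting [h] to 0 on the null set [N] keeps its integral and puts it below [g] everywhere. *)
pose h' := proj_nnsfun h (measurableC mN).
apply: (@le_trans _ _ (sintegral mu h')); last first.
  apply: ereal_sup_ubound; exists h' => //= x.
  rewrite mindicE; case: (asboolP (N x)) => Nx.
    rewrite memNset ?mulr0; last by move/(_ Nx).
    by rewrite patchE; case: ifPn => // /set_mem /g0.
  rewrite mem_set// mulr1; have := hf x; rewrite !patchE.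
  case: ifPn => // /set_mem Dx /le_trans; apply.
  apply: contrapT => fg; apply: Nx; apply: fgN => /= /(_ Dx); exact: fg.
rewrite -!integralT_nnsfun; apply: ae_ge0_le_integral => //=.
- by move=> x _; rewrite lee_fin.
- exact/measurable_EFinP.
- by move=> x _; rewrite lee_fin mulr_ge0.
- by apply/measurable_EFinP; apply: measurable_funM.
- exists N; split => //= x /=; apply: contra_notP => Nx _.
  by rewrite mindicE mem_set// mulr1.
Qed.

End lower_integral.

Section step_theory.
Variables (R : realType) (X : hilbertType R).
Local Notation mu := (@lebesgue_measure R).
Implicit Types (D : set R) (s p : seq (set R * X)).

Lemma step_fun_nil t : step_fun ([::] : seq (set R * X)) t = 0.
Proof. by rewrite /step_fun big_nil. Qed.

Lemma step_fun_cons q s t :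
  step_fun (q :: s) t = (\1_(q.1) t : R) *: q.2 + step_fun s t.
Proof. by rewrite /step_fun big_cons. Qed.

Lemma step_fun_cat s p t : step_fun (s ++ p) t = step_fun s t + step_fun p t.
Proof. by rewrite /step_fun big_cat. Qed.

Lemma step_int_cat s p : step_int (s ++ p) = step_int s + step_int p.
Proof. by rewrite /step_int big_cat. Qed.

Lemma step_on_cat D s p : step_on D s -> step_on D p -> step_on D (s ++ p).
Proof. by move=> hs hp q; rewrite mem_cat => /orP[/hs|/hp]. Qed.

Lemma step_on_cons D q s : step_on D (q :: s) ->
  [/\ measurable q.1, q.1 `<=` D & (mu q.1 < +oo)%E] /\ step_on D s.
Proof.
by move=> h; split; [apply: h; rewrite mem_head|move=> r rs; apply: h; rewrite inE rs orbT].
Qed.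

(** A step function takes finitely many values on measurable pieces. Splitting on the head set
    shifts the argument of [F], so the induction generalizes over [F]. *)
Lemma measurable_comp_step D s (F : X -> R) : step_on D s ->
  measurable_fun [set: R] (fun t => F (step_fun s t)).
Proof.
elim: s F => [|q s ih] F hs.
  by under eq_fun do rewrite step_fun_nil; exact: measurable_cst.
have [[mq _ _] {}hs] := step_on_cons hs.
rewrite (_ : (fun t => _) = (fun t => \1_(q.1) t * F (q.2 + step_fun s t) +
  (1 - \1_(q.1) t) * F (step_fun s t))); last first.
  apply/funext => t; rewrite step_fun_cons indicE; case: (t \in q.1).
    by rewrite scale1r mul1r subrr mul0r addr0.
  by rewrite scale0r mul0r subr0 mul1r !add0r.
apply: measurable_funD; apply: measurable_funM.
- exact: measurable_indic.
- exact: (ih (fun x => F (q.2 + x))).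
- by apply: measurable_funB; [exact: measurable_cst|exact: measurable_indic].
- exact: ih.
Qed.

Lemma integrable_indic_scale D A (c : R) : measurable D -> measurable A ->
  (mu A < +oo)%E -> mu.-integrable D (EFin \o (fun t => \1_A t * c)).
Proof.
move=> mD mA Aoo; rewrite (_ : _ \o _ = (fun t => c%:E * (\1_A t)%:E)%E).
  apply: integrableZl => //; apply/integrableP; split.
    by apply/measurable_EFinP; exact: measurable_indic.
  under eq_integral do rewrite gee0_abs ?lee_fin//.
  rewrite integral_indic// (le_lt_trans _ Aoo)// le_measure// inE//.
  exact: measurableI.
by apply/funext => t /=; rewrite -EFinM mulrC.
Qed.

Lemma integrable_norm_step D s : measurable D -> step_on D s ->
  mu.-integrable D (EFin \o (fun t => `|step_fun s t|)).
Proof.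
move=> mD; elim: s => [|q s ih] hs.
  by under [_ \o _]eq_fun do rewrite /= step_fun_nil normr0; exact: integrable0.
have [[mq qD qoo] hs'] := step_on_cons hs.
have := @integrableD _ _ _ mu _ mD _ _ (integrable_indic_scale `|q.2| mD mq qoo) (ih hs').
apply: le_integrable => //.
  apply/measurable_EFinP; apply: measurable_funTS.
  exact: (measurable_comp_step _ hs).
move=> t Dt /=; rewrite lee_fin normr_id step_fun_cons.
rewrite ger0_norm; last by rewrite addr_ge0// mulr_ge0.
by rewrite (le_trans (ler_normD _ _))// normrZ ger0_norm.
Qed.

Lemma integrable_inner_step D s x : measurable D -> step_on D s ->
  mu.-integrable D (EFin \o (fun t => inner (step_fun s t) x)).
Proof.
move=> mD; elim: s => [|q s ih] hs.
  by under [_ \o _]eq_fun do rewrite /= step_fun_nil inner0l; exact: integrable0.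
have [[mq qD qoo] hs'] := step_on_cons hs.
have := @integrableD _ _ _ mu _ mD _ _ (integrable_indic_scale (inner q.2 x) mD mq qoo) (ih hs').
by apply: eq_integrable => // t _ /=; rewrite step_fun_cons innerDl innerZl.
Qed.

(** The bridge to real integrals, where order estimates are available. *)
Lemma Rintegral_inner_step D s x : measurable D -> step_on D s ->
  \int[mu]_(t in D) inner (step_fun s t) x = inner (step_int s) x.
Proof.
move=> mD; elim: s => [|q s ih] hs.
  rewrite /step_int big_nil inner0l; under eq_Rintegral do rewrite step_fun_nil inner0l.
  by rewrite Rintegral_cst// mul0r.
have [[mq qD qoo] hs'] := step_on_cons hs.
under eq_Rintegral do rewrite step_fun_cons innerDl innerZl.
rewrite RintegralD//; last 2 first.
- exact: integrable_indic_scale.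
- exact: integrable_inner_step.
rewrite ih// /step_int big_cons innerDl innerZl; congr (_ + _).
rewrite RintegralZr//; last first.
  by have := integrable_indic_scale 1 mD mq qoo; apply: eq_integrable => // t _ /=; rewrite mulr1.
by rewrite /Rintegral integral_indic// setIidl.
Qed.

End step_theory.

Section step_map.
Variables (R : realType) (X Y : hilbertType R) (L : X -> Y).
Hypothesis lL : linear L.

(** Besides coordinate maps, [L] will also be negation, so that concatenation can encode differences
    of step functions. *)
Definition step_map (s : seq (set R * X)) := [seq (q.1, L q.2) | q <- s].

Lemma step_fun_map s t : step_fun (step_map s) t = L (step_fun s t).
Proof.
have [L0 LD _ _ LZ] := linearFE lL.
rewrite /step_fun big_map; elim: s => [|q s ih]; first by rewrite !big_nil L0.
by rewrite !big_cons/= LD LZ ih.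
Qed.

Lemma step_int_map s : step_int (step_map s) = L (step_int s).
Proof.
have [L0 LD _ _ LZ] := linearFE lL.
rewrite /step_int big_map; elim: s => [|q s ih]; first by rewrite !big_nil L0.
by rewrite !big_cons/= LD LZ ih.
Qed.

Lemma step_on_map D s : step_on D s -> step_on D (step_map s).
Proof. by move=> hs _ /mapP[q qs ->] /=; exact: hs. Qed.

End step_map.

Section bochner_theory.
Variables (R : realType).
Local Notation mu := (@lebesgue_measure R).

(** A measurable stand-in for the distance from [f] to a step function, used wherever integrals are
    added or integrability is claimed. The distance is almost everywhere the limit of norms of step
    functions, which are measurable. *)
Lemma dist_step_measurable (X : hilbertType R) (D : set R)
    (s : nat -> seq (set R * X)) (f : R -> X) (p : seq (set R * X)) :
  (forall n, step_on D (s n)) -> step_on D p ->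
  {ae mu, forall t, D t -> step_fun (s n) t @[n --> \oo] --> f t} ->
  exists g : R -> R, [/\ measurable_fun [set: R] g, forall t, 0 <= g t &
    {ae mu, forall t, D t -> g t = `|f t - step_fun p t|}].
Proof.
move=> sD pD sf.
(* The upper limit is measurable on the whole line and equals the limit where there is one. *)
pose G t : \bar R :=
  `|limn_esup (fun n => `|step_fun (s n ++ step_map -%R p) t|%:E)|%E.
exists (fine \o G); split.
- apply: measurableT_comp; first exact: fine_measurable.
  apply: measurableT_comp => //; apply: measurable_fun_limn_esup => n.
  apply/measurable_EFinP; apply: (@measurable_comp_step _ _ D).
  by apply: step_on_cat; [exact: sD|exact: step_on_map].
- by move=> t; apply: fine_ge0; exact: abse_ge0.
- move: sf; apply: filterS => t /[apply] sft.
  have st : `|step_fun (s n ++ step_map -%R p) t|%:E @[n --> \oo] -->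
      (`|f t - step_fun p t|%:E : \bar R).
    have stE n : step_fun (s n ++ step_map -%R p) t =
        step_fun (s n) t - step_fun p t.
      by rewrite step_fun_cat step_fun_map// => a x y; rewrite opprD scalerN.
    under eq_fun do rewrite stE.
    apply/fine_cvgP; split; first exact: nearW.
    exact: (cvg_norm (cvgB sft (cvg_cst (step_fun p t)))).
  by rewrite /= /G (cvg_limn_einf_sup st).2 gee0_abs ?lee_fin.
Qed.

(** As [L] does not increase norms, the images of the approximants approximate at least as well. *)
Lemma is_bochner_comp (X Y : hilbertType R) (L : X -> Y) (D : set R)
    (f : R -> X) w : measurable D -> linear L ->
  (forall x, `|L x| <= `|x|) -> is_bochner D f w ->
  is_bochner D (fun t => L (f t)) (L w).
Proof.
move=> mD lL L1 [s [sD sf s0 sw]].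
have bL : bounded_linear L by split => //; exists 1 => u; rewrite mul1r.
exists (fun n => step_map L (s n)); split.
- by move=> n; exact: step_on_map.
- move: sf; apply: filterS => t /[apply] sft.
  under eq_fun do rewrite step_fun_map//.
  exact: bounded_linear_cvg.
- apply: squeeze_cvge (cvg_cst 0%E) s0.
  apply: nearW => n; rewrite integral_ge0//=.
  apply: ge0_ae_le_lower_integral => //; apply: aeW => t _.
  rewrite lee_fin step_fun_map//; have [_ _ <- _ _] := linearFE lL.
  exact: L1.
- by under eq_fun do rewrite step_int_map//; exact: bounded_linear_cvg.
Qed.

Lemma is_bochnerD (X : hilbertType R) (D : set R) (f g : R -> X) w v :
  measurable D -> is_bochner D f w -> is_bochner D g v ->
  is_bochner D (fun t => f t + g t) (w + v).
Proof.
move=> mD [s [sD sf s0 sw]] [r [rD rf r0 rw]].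
exists (fun n => s n ++ r n); split.
- by move=> n; exact: step_on_cat.
- apply: filterS2 sf rf => t sft rft Dt.
  under eq_fun do rewrite step_fun_cat.
  by apply: cvgD; [exact: sft|exact: rft].
- have := @cvgeD _ _ eventually_filter _ _ _ 0%E 0%E isT s0 r0; rewrite adde0 => sr0.
  apply: squeeze_cvge (cvg_cst 0%E) sr0.
  apply: nearW => n; rewrite integral_ge0//=.
  (* The triangle inequality is integrated through [g1] and [g2], because splitting the integral of
     a sum uses measurability. *)
  have [g1 [mg1 g10 g1E]] := dist_step_measurable sD (sD n) sf.
  have [g2 [mg2 g20 g2E]] := dist_step_measurable rD (rD n) rf.
  apply: (@le_trans _ _ (\int[mu]_(t in D) (g1 t + g2 t)%:E)%E).
    apply: ge0_ae_le_lower_integral => //.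
      by move=> t _; rewrite lee_fin addr_ge0.
    apply: filterS2 g1E g2E => t g1t g2t Dt.
    rewrite g1t// g2t//.
    by rewrite lee_fin step_fun_cat opprD addrACA ler_normD.
  under eq_integral do rewrite EFinD.
  rewrite ge0_integralD//; last 4 first.
  + by move=> t _; rewrite lee_fin.
  + by apply/measurable_EFinP; exact: measurable_funTS.
  + by move=> t _; rewrite lee_fin.
  + by apply/measurable_EFinP; exact: measurable_funTS.
  apply: leeD; apply: (@ge0_ae_le_lower_integral _ _ _ mu) => //.
  + by move=> t _; rewrite lee_fin.
  + by apply: filterS g1E => t g1t Dt; rewrite g1t.
  + by move=> t _; rewrite lee_fin.
  + by apply: filterS g2E => t g2t Dt; rewrite g2t.
- by under eq_fun do rewrite step_int_cat; exact: cvgD.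
Qed.

(** One step function at finite integral distance from [f] is enough: its norm plus that distance is
    the majorant. *)
Lemma bochner_norm_dominated (X : hilbertType R) (D : set R) (f : R -> X) :
  measurable D -> bochner_integrable D f ->
  exists g : R -> R, [/\ measurable_fun [set: R] g, forall t, 0 <= g t,
    mu.-integrable D (EFin \o g) & {ae mu, forall t, D t -> `|f t| <= g t}].
Proof.
move=> mD [w [s [sD sf s0 sw]]].
have [n soo] : exists n, (\int[mu]_(t in D) `|f t - step_fun (s n) t|%:E < +oo)%E.
  have /fine_cvgP[[n _ sn] _] := s0; exists n.
  by rewrite ltey_eq sn//=.
have [g [mg g0 gE]] := dist_step_measurable sD (sD n) sf.
have ms := measurable_comp_step (fun x => `|x|) (sD n).
exists (fun t => g t + `|step_fun (s n) t|); split.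
- exact: measurable_funD.
- by move=> t; rewrite addr_ge0.
- have ig : mu.-integrable D (EFin \o g).
    apply/integrableP; split.
      by apply/measurable_EFinP; exact: measurable_funTS.
    apply: le_lt_trans soo; apply: ge0_ae_le_lower_integral => //.
    by apply: filterS gE => t gt Dt; rewrite /= -gt// ger0_norm.
  have iS := integrable_norm_step mD (sD n).
  exact: (@integrableD _ _ _ mu _ mD _ _ ig iS).
- apply: filterS gE => t gt Dt; rewrite gt//.
  by rewrite (le_trans _ (ler_normD _ _))// subrK.
Qed.

(** Almost everywhere <s_n, x> exceeds [g] by at most |x| |f - s_n|, and the integral of this excess
    tends to 0. *)
Lemma inner_bochner_le (X : hilbertType R) (D : set R) (f : R -> X) w (x : X)
    (g : R -> R) : measurable D -> is_bochner D f w ->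
  mu.-integrable D (EFin \o g) ->
  {ae mu, forall t, D t -> inner (f t) x <= g t} ->
  inner w x <= \int[mu]_(t in D) g t.
Proof.
move=> mD [s [sD sf s0 sw]] ig fg; pose c := `|x| + 1.
have c0 : 0 < c by rewrite ltr_pwDr.
apply/ler_addgt0Pr => e e0.
have swx : inner (step_int (s n)) x @[n --> \oo] --> inner w x.
  by apply: cvg_inner => //; exact: cvg_cst.
apply: (cvgr_to_le swx).
have /fine_cvgP[sfin s0'] := s0.
have ec0 : 0 < e / c by rewrite divr_gt0.
move/cvgrPdist_lt : s0' => /(_ _ ec0) s0'.
near=> n.
have Ifin : (\int[mu]_(t in D) `|f t - step_fun (s n) t|%:E)%E \is a fin_num.
  by near: n.
have Ilt : fine (\int[mu]_(t in D) `|f t - step_fun (s n) t|%:E)%E < e / c.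
  have : `|0 - fine (\int[mu]_(t in D) `|f t - step_fun (s n) t|%:E)%E| < e / c.
    by near: n.
  by rewrite sub0r normrN; exact/le_lt_trans/ler_norm.
(* Positive part of the excess over [g]. It is measurable and, as [c] exceeds |x|, lies almost
   everywhere below |f - s_n|; so its integral is below e / c. *)
pose h t := Num.max 0 (inner (step_fun (s n) t) x - g t) / c.
have ii := integrable_inner_step x mD (sD n).
have h0 t : 0 <= h t by rewrite /h divr_ge0 ?(ltW c0)// le_max lexx.
have hle t : inner (step_fun (s n) t) x <= g t + c * h t.
  rewrite /h mulrC divfK ?gt_eqF// -lerBlDl le_max lexx orbT //.
have ih : (\int[mu]_(t in D) (h t)%:E <=
    \int[mu]_(t in D) `|f t - step_fun (s n) t|%:E)%E.
  apply: ge0_ae_le_lower_integral => //; first by move=> t _; rewrite lee_fin.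
  apply: filterS fg => t + Dt => /(_ Dt) fgt; rewrite lee_fin /h.
  rewrite ler_pdivrMr// ge_max mulr_ge0 ?(ltW c0)//=.
  rewrite (@le_trans _ _ (inner (step_fun (s n) t - f t) x))//.
    by rewrite innerBl lerB.
  rewrite (le_trans (inner_le_norm _ _))// distrC ler_wpM2l// /c lerDl//.
have mh : measurable_fun D h.
  apply: measurable_funM => //; apply: measurable_maxr => //.
  apply: measurable_funB; last by apply/measurable_EFinP; exact: measurable_int ig.
  by apply/measurable_EFinP; exact: measurable_int ii.
have inth : mu.-integrable D (EFin \o h).
  apply/integrableP; split; first exact/measurable_EFinP.
  under eq_integral do rewrite /= ger0_norm//.
  by rewrite (le_lt_trans ih)// ltey_eq Ifin.
have intch : mu.-integrable D (EFin \o (fun t => c * h t)).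
  exact: (@integrableZl _ _ _ mu _ mD c _ inth).
rewrite -(Rintegral_inner_step x mD (sD n)).
apply: (@le_trans _ _ (\int[mu]_(t in D) (g t + c * h t))).
  apply: le_Rintegral => //.
  exact: (@integrableD _ _ _ mu _ mD _ _ ig intch).
rewrite RintegralD// lerD2l RintegralZl// mulrC -ler_pdivlMr//.
apply: le_trans (ltW Ilt); apply: fine_le => //.
by apply: integrable_fin_num.
Unshelve. all: by end_near. Qed.

End bochner_theory.

(** * Weak derivatives and increments *)

Lemma is_derive_cvgP (R : realType) (V : normedModType R) (x : R -> V) (t : R)
    v : is_derive t (1 : R) x v <->
  h^-1 *: ((x \o shift t) (h *: (1 : R)) - x t) @[h --> 0^'] --> v.
Proof.
split=> [[/cvg_ex[l xl] <-]|xv]; first by rewrite /derive (cvg_lim _ xl).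
by apply: DeriveDef; [apply/cvg_ex; exists v|exact: cvg_lim].
Qed.

(** * Quadratic cut-off functions *)

Section smooth_step.
Variable R : realType.
Implicit Types (r s t h e : R) (f : R -> R).

(** A second-order remainder bound survives sums and rescaling, so the spline is differentiated
    without a case analysis over all its knots. *)
Lemma is_derive_quadratic_error f t l K : 0 <= K ->
  (forall h, `|f (t + h) - f t - l * h| <= K * h ^+ 2) -> is_derive t 1 f l.
Proof.
move=> K0 fK; apply/is_derive_cvgP/cvgrPdist_le => e e0; near=> h.
have h0 : h != 0 by near: h; exact: nbhs_dnbhs_neq.
have -> : l - h^-1 *: ((f \o shift t) (h *: (1 : R)) - f t) =
    - (h^-1 * (f (t + h) - f t - l * h)).
  have scaleE (a b : R) : a *: (b : R^o) = a * b by [].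
  rewrite /shift/= !scaleE mulr1 (addrC h) [in RHS]mulrBr.
  by rewrite [h^-1 * (l * h)]mulrCA mulVf// mulr1 opprB.
rewrite normrN normrM normfV ler_pdivrMl ?normr_gt0//.
rewrite (le_trans (fK h))// -[h ^+ 2]real_normK ?num_real// expr2 mulrCA.
(* [K + 1] is the divisor because [K] may be 0. *)
rewrite ler_wpM2l// -(@ler_pM2l _ (K + 1)^-1) ?invr_gt0 ?ltr_wpDl//.
rewrite (@le_trans _ _ `|h|)//.
  by rewrite mulrA ler_piMl// mulrC ler_pdivrMr ?ltr_wpDl// mul1r lerDl.
near: h; apply: dnbhs0_le; rewrite mulr_gt0// invr_gt0 ltr_wpDl//.
Unshelve. all: by end_near. Qed.

Definition pospart (r : R) : R := Num.max 0 r.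

Lemma pospart_pos r : 0 <= r -> pospart r = r.
Proof. by move=> r0; exact/max_idPr. Qed.

Lemma pospart_neg r : r <= 0 -> pospart r = 0.
Proof. by move=> r0; exact/max_idPl. Qed.

(** The squared positive part has the Lipschitz derivative [2 * pospart t]; the only kink of that
    derivative is at 0, whence the cases on the signs of both endpoints. *)
Lemma sqr_pospart_error t h :
  `|pospart (t + h) ^+ 2 - pospart t ^+ 2 - 2 * pospart t * h| <= h ^+ 2.
Proof.
have [t0|t0] := leP 0 t; have [th0|th0] := leP 0 (t + h).
- by rewrite !pospart_pos// ler_norml; apply/andP; split; nra.
- by rewrite (pospart_pos t0) pospart_neg ?(ltW th0)// ler_norml; apply/andP; split; nra.
- by rewrite (pospart_neg (ltW t0)) pospart_pos// ler_norml; apply/andP; split; nra.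
- by rewrite !pospart_neg ?(ltW t0) ?(ltW th0)// ler_norml; apply/andP; split; nra.
Qed.

Lemma continuous_pospart : continuous pospart.
Proof.
have -> : pospart = fun r => (r + `|r|) / 2.
  apply/funext => r; have [r0|r0] := leP 0 r.
    by rewrite pospart_pos// ger0_norm//; lra.
  by rewrite pospart_neg ?(ltW r0)// ltr0_norm//; lra.
move=> r; apply: cvgM; last exact: cvg_cst.
by apply: cvgD; [exact: cvg_id|apply: cvg_norm; exact: cvg_id].
Qed.

(* The C^1 quadratic spline rising from 0 on ]-oo, s] to 1 on [s + 2 e, +oo[,
   and its derivative, a tent. *)
Definition unit_step r : R :=
  (pospart r ^+ 2 - 2 * pospart (r - 1) ^+ 2 + pospart (r - 2) ^+ 2) / 2.

Definition unit_tent r : R :=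
  pospart r - 2 * pospart (r - 1) + pospart (r - 2).

Definition smooth_step s e r := unit_step ((r - s) / e).

Definition tent s e r := unit_tent ((r - s) / e) / e.

(** The weights 1, 2, 1 of the three squares, halved, add up to the constant 2. *)
Lemma unit_step_error t h :
  `|unit_step (t + h) - unit_step t - unit_tent t * h| <= 2 * h ^+ 2.
Proof.
have := sqr_pospart_error t h; have := sqr_pospart_error (t - 1) h.
have := sqr_pospart_error (t - 2) h; rewrite ![t - _ + h]addrAC.
rewrite /unit_step /unit_tent !ler_norml => /andP[a1 a2] /andP[b1 b2] /andP[c1 c2].
by apply/andP; split; lra.
Qed.

Lemma is_derive_smooth_step s e t : 0 < e ->
  is_derive t 1 (smooth_step s e) (tent s e t).
Proof.
move=> e0; apply: (@is_derive_quadratic_error _ _ _ (2 / e ^+ 2)).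
  by rewrite divr_ge0// exprn_ge0// ltW.
move=> h; have := unit_step_error ((t - s) / e) (h / e).
rewrite /smooth_step /tent.
have -> : (t + h - s) / e = (t - s) / e + h / e by ring.
have -> : unit_tent ((t - s) / e) / e * h = unit_tent ((t - s) / e) * (h / e).
  by ring.
suff -> : 2 * (h / e) ^+ 2 = 2 / e ^+ 2 * h ^+ 2 by [].
by rewrite expr_div_n; ring.
Qed.

Lemma unit_step_le0 r : r <= 0 -> unit_step r = 0.
Proof.
by move=> r0; rewrite /unit_step !pospart_neg; [ring|lra|lra|lra].
Qed.

Lemma unit_step_ge2 r : 2 <= r -> unit_step r = 1.
Proof.
by move=> r0; rewrite /unit_step !pospart_pos; [field|lra|lra|lra].
Qed.

Lemma unit_step_itv r : 0 <= unit_step r <= 1.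
Proof.
rewrite /unit_step.
have [r0|r0] := leP r 0; first by rewrite !pospart_neg; lra.
rewrite (pospart_pos (ltW r0)).
have [r1|r1] := leP r 1; first by rewrite !pospart_neg; nra.
rewrite (pospart_pos (_ : 0 <= r - 1)); last lra.
have [r2|r2] := leP r 2; first by rewrite !pospart_neg; nra.
by rewrite !pospart_pos; lra.
Qed.

Lemma unit_tent_ge0 r : 0 <= unit_tent r.
Proof.
rewrite /unit_tent.
have [r0|r0] := leP r 0; first by rewrite !pospart_neg; lra.
rewrite (pospart_pos (ltW r0)).
have [r1|r1] := leP r 1; first by rewrite !pospart_neg; lra.
rewrite (pospart_pos (_ : 0 <= r - 1)); last lra.
have [r2|r2] := leP r 2; first by rewrite !pospart_neg; lra.
by rewrite !pospart_pos; lra.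
Qed.

Lemma unit_tent_out r : ~~ (0 < r < 2) -> unit_tent r = 0.
Proof.
rewrite negb_and -!leNgt /unit_tent => /orP[r0|r2].
  by rewrite !pospart_neg; lra.
by rewrite !pospart_pos; lra.
Qed.

Lemma smooth_step_le s e r : 0 < e -> r <= s -> smooth_step s e r = 0.
Proof. by move=> e0 rs; rewrite /smooth_step unit_step_le0// pmulr_lle0 ?invr_gt0// subr_le0. Qed.

Lemma smooth_step_ge s e r : 0 < e -> s + 2 * e <= r -> smooth_step s e r = 1.
Proof. by move=> e0 rs; rewrite /smooth_step unit_step_ge2// ler_pdivlMr// lerBrDl. Qed.

Lemma smooth_step_itv s e r : 0 <= smooth_step s e r <= 1.
Proof. exact: unit_step_itv. Qed.

Lemma tent_ge0 s e r : 0 < e -> 0 <= tent s e r.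
Proof. by move=> e0; rewrite divr_ge0 ?unit_tent_ge0// ltW. Qed.

Lemma tent_out s e r : 0 < e -> ~~ (s < r < s + 2 * e) -> tent s e r = 0.
Proof.
move=> e0; apply: contraNeq => h.
have : 0 < (r - s) / e < 2.
  by apply: contraNT h => h; rewrite /tent unit_tent_out// mul0r.
by rewrite ltr_pdivlMr// mul0r ltr_pdivrMr// subr_gt0 ltrBlDl.
Qed.

Lemma continuous_tent s e : continuous (tent s e).
Proof.
have cp a : continuous (fun r => pospart (r - a)).
  move=> r; apply: (@continuous_comp R R R (fun r => r - a) pospart r).
    by apply: cvgB; [exact: cvg_id|exact: cvg_cst].
  exact: continuous_pospart.
have ct : continuous unit_tent.
  move=> r; apply: cvgD; last exact: cp.
  apply: cvgB; first exact: continuous_pospart.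
  by apply: cvgM; [exact: cvg_cst|exact: cp].
move=> r; apply: cvgM; last exact: cvg_cst.
apply: (@continuous_comp R R R (fun r => (r - s) / e) unit_tent r).
  by apply: cvgM; [apply: cvgB; [exact: cvg_id|exact: cvg_cst]|exact: cvg_cst].
exact: ct.
Qed.

Local Notation mu := (@lebesgue_measure R).

Lemma integrable_tent a b s e : mu.-integrable `]a, b[ (EFin \o tent s e).
Proof.
apply: (@integrableS _ _ _ mu `[a, b]) => //.
  exact: subset_itv_oo_cc.
apply: continuous_compact_integrable; first exact: segment_compact.
by apply: continuous_subspaceT => r; exact: continuous_tent.
Qed.

(** The tent is the derivative of a step that rises from 0 to 1 within the interval. *)
Lemma Rintegral_tent a b s e : 0 < e -> a <= s -> s + 2 * e <= b ->
  \int[mu]_(r in `]a, b[) tent s e r = 1.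
Proof.
move=> e0 as_ sb.
have ab : a < b by lra.
have m1 : measurable_fun `]a, b[ (EFin \o tent s e).
  exact: measurable_int (integrable_tent a b s e).
rewrite /Rintegral -(@integral_itv_bndoo _ a b _ true false)//.
rewrite (@continuous_FTC2 _ _ (smooth_step s e))//=.
- by rewrite smooth_step_ge// smooth_step_le// subr0.
- by apply: continuous_subspaceT => r; exact: continuous_tent.
- have cs r : {for r, continuous (smooth_step s e)}.
    by apply: differentiable_continuous; apply/derivable1_diffP; have [] := is_derive_smooth_step s r e0.
  split; first by move=> r _; have [] := is_derive_smooth_step s r e0.
    by apply: cvg_at_right_filter; exact: cs.
  by apply: cvg_at_left_filter; exact: cs.
- by move=> r _; rewrite derive1E; have [] := is_derive_smooth_step s r e0.
Qed.

End smooth_step.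

(** * Increment bound for functions with an integrable weak derivative *)

Section W11_increment.
Variable R : realType.
Local Notation mu := (@lebesgue_measure R).

Lemma Rintegral_itv_cat (g : R -> R) (s t u : R) :
  mu.-integrable [set: R] (EFin \o g) -> s <= t -> t <= u ->
  \int[mu]_(r in `]s, u]) g r =
  \int[mu]_(r in `]s, t]) g r + \int[mu]_(r in `]t, u]) g r.
Proof.
move=> ig st tu; apply/eqP; rewrite addrC -subr_eq; apply/eqP.
apply: Rintegral_itvB; rewrite ?bnd_simp//.
exact: (@integrableS _ _ _ mu setT).
Qed.

(** A C^1 version of the indicator of ]s, t]. Its derivative, a unit-mass tent at [s] minus one at
    [t], extracts approximately x s - x t. *)
Lemma test_function_steps (a b s t e : R) : 0 < e -> a < s -> s <= t ->
  t + 2 * e < b ->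
  test_function a b (fun r => smooth_step s e r - smooth_step t e r) /\
  derive1 (fun r => smooth_step s e r - smooth_step t e r) =
  (fun r => tent s e r - tent t e r).
Proof.
move=> e0 as_ st tb.
pose phi := fun r => smooth_step s e r - smooth_step t e r.
have dphi (r : R) : is_derive r (1 : R) phi (tent s e r - tent t e r).
  by apply: is_deriveB; exact: is_derive_smooth_step.
have dE : derive1 phi = (fun r => tent s e r - tent t e r).
  by apply/funext => r; rewrite derive1E; exact: derive_val.
split => //; split.
- by move=> r; have [] := dphi r.
- by rewrite dE => r; apply: cvgB; exact: continuous_tent.
- exists s, (t + 2 * e); split => // r; rewrite in_itv/= negb_and -!ltNge.
  move=> /orP[rs|tr].
    by rewrite !smooth_step_le ?subrr//; lra.
  by rewrite !smooth_step_ge ?subrr//; lra.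
Qed.

(** In the application [q] is |x t - x s|, [i] pairs the test integral with x t - x s, and [I], [J]
    are the masses of [g] on ]s, t] and on the overhang to its right. Add the bounds and divide by
    [q]. *)
Let increment_arith (i I J e q : R) : i <= - q ^+ 2 + 2 * e * q ->
  - i <= (I + J) * q -> J <= e -> 0 < q -> q <= I + 3 * e.
Proof.
move=> A B C q0; rewrite -(ler_pM2r q0).
by have := ler_wpM2r (ltW q0) C; lra.
Qed.

(* Testing the weak derivative against smoothed indicators of [s, t]. *)
Lemma W11_increment (X : hilbertType R) (a b : R) (x : R -> X) :
  W11 a b x -> (forall r, r \in `]a, b[ -> {for r, continuous x}) ->
  exists g : R -> R, [/\ mu.-integrable [set: R] (EFin \o g),
    forall r, 0 <= g r &
    forall s t, a < s -> s <= t -> t < b ->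
      `|x t - x s| <= \int[mu]_(r in `]s, t]) g r].
Proof.
move=> [_ [v iv wv]] cx.
have mD : measurable (`]a, b[ : set R) by [].
have [g0 [mg0 g00 ig0 vg0]] := bochner_norm_dominated mD iv.
pose g := g0 \_ `]a, b[.
have ig : mu.-integrable [set: R] (EFin \o g).
  rewrite -restrict_EFin.
  apply/(@integrable_restrict _ _ _ mu _ mD _ measurableT).
  by rewrite setTI.
have gge0 r : 0 <= g r by rewrite /g patchE; case: ifP.
have igA (A : set R) : measurable A -> mu.-integrable A (EFin \o g).
  by move=> mA; exact: (@integrableS _ _ _ mu setT).
exists g; split => // s t as_; rewrite le_eqVlt => /predU1P[<-|st] tb.
  by rewrite subrr normr0; exact: Rintegral_ge0.
set p := x s - x t.
have -> : `|x t - x s| = `|p| by rewrite distrC.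
have [p0|p0] := eqVneq `|p| 0; first by rewrite p0; exact: Rintegral_ge0.
have {}p0 : 0 < `|p| by rewrite lt_neqAle eq_sym p0 normr_ge0.
(* A third for each error: the variation of [x] near [s], the one near [t], and the mass of [g] on
   the overhang ]t, t + 2 h]. *)
apply/ler_addgt0Pr => e3 e30; pose e := e3 / 3.
have e0 : 0 < e by rewrite divr_gt0.
have near_x r : a < r -> r < b ->
    \forall h \near 0^'+, forall q, r < q < r + 2 * h -> `|x q - x r| <= e.
  move=> ar rb; have rab : r \in `]a, b[ by rewrite in_itv/= ar.
  have /cvgrPdist_le/(_ _ e0)/nbhs_ballP[d /= d0 dP] := cx r rab.
  near=> h => q /andP[rq qr]; rewrite distrC; apply: dP.
  rewrite /ball/= distrC ger0_norm ?subr_ge0 ?(ltW rq)//.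
  have : h < d / 2 by near: h; apply: nbhs_right_lt; rewrite divr_gt0.
  by lra.
have near_g : \forall h \near 0^'+, \int[mu]_(r in `]t, t + 2 * h]) g r <= e.
  have := parameterized_integral_near_left tb e0 (igA `[t, b]%classic (measurable_itv _)).
  move=> /nbhs_ballP[d /= d0 dP].
  near=> h.
  have h0 : 0 < h by near: h; exact: nbhs_right_gt.
  have hd : h < d / 2 by near: h; apply: nbhs_right_lt; rewrite divr_gt0.
  rewrite Rintegral_itv_obnd_cbnd; last exact: igA.
  have := dP (t + 2 * h); rewrite /ball/= opprD addrA subrr add0r normrN.
  rewrite ger0_norm; last lra.
  move=> /(_ ltac:(lra) ltac:(lra)); rewrite /parameterized_integral.
  by move=> /(le_lt_trans (ler_norm _))/ltW.
near (0 : R)^'+ => h.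
have h0 : 0 < h by near: h; exact: nbhs_right_gt.
have thb : t + 2 * h < b.
  have : h < (b - t) / 2.
    by near: h; apply: nbhs_right_lt; rewrite divr_gt0// subr_gt0.
  by lra.
have xs : forall q, s < q < s + 2 * h -> `|x q - x s| <= e.
  by near: h; apply: near_x => //; exact: lt_trans tb.
have xt : forall q, t < q < t + 2 * h -> `|x q - x t| <= e.
  by near: h; apply: near_x => //; exact: lt_trans st.
have gh : \int[mu]_(r in `]t, t + 2 * h]) g r <= e by near: h.
have [tf dE] := test_function_steps h0 as_ (ltW st) thb.
have [w] := wv _ tf; rewrite dE => bw bNw.
have Rs : \int[mu]_(r in `]a, b[) tent s h r = 1.
  by apply: Rintegral_tent => //; lra.
have Rt : \int[mu]_(r in `]a, b[) tent t h r = 1.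
  by apply: Rintegral_tent => //; lra.
(* First reading of [w], through [x]: the tents average values within [e] of x s and of x t, so [w]
   is nearly [p]. *)
have A : inner w (- p) <= - `|p| ^+ 2 + 2 * e * `|p|.
  have is_ c : mu.-integrable `]a, b[ (EFin \o (fun r => tent s h r * c)).
    have := @integrableZr _ _ _ mu _ mD c _ (integrable_tent a b s h).
    by apply: eq_integrable.
  have it c : mu.-integrable `]a, b[ (EFin \o (fun r => tent t h r * c)).
    have := @integrableZr _ _ _ mu _ mD c _ (integrable_tent a b t h).
    by apply: eq_integrable.
  have Zs c : \int[mu]_(r in `]a, b[) (tent s h r * c) = c.
    rewrite (@RintegralZr _ _ _ mu _ (tent s h))//; last exact: integrable_tent.
    by rewrite Rs mul1r.
  have Zt c : \int[mu]_(r in `]a, b[) (tent t h r * c) = c.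
    rewrite (@RintegralZr _ _ _ mu _ (tent t h))//; last exact: integrable_tent.
    by rewrite Rt mul1r.
  have := @inner_bochner_le _ _ _ _ _ (- p) (fun r =>
    tent s h r * (e * `|p| - inner (x s) p) +
    tent t h r * (inner (x t) p + e * `|p|)) mD bw.
  rewrite RintegralD// !(Zs, Zt).
  move=> /(_ (@integrableD _ _ _ mu _ mD _ _ (is_ _) (it _))).
  have -> : e * `|p| - inner (x s) p + (inner (x t) p + e * `|p|) =
      - `|p| ^+ 2 + 2 * e * `|p|.
    by rewrite -innerxx {3}/p innerBl; ring.
  apply; apply: aeW => r _; rewrite innerZl innerNr mulrBl !mulrN opprK.
  have bound c q : `|x q - x c| <= e ->
      - (e * `|p|) <= inner (x q) p - inner (x c) p <= e * `|p|.
    move=> xqc; rewrite -innerBl -ler_norml (le_trans (normr_inner_le _ _))//.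
    by rewrite ler_wpM2r.
  have Es : - (tent s h r * inner (x r) p) <=
      tent s h r * (e * `|p| - inner (x s) p).
    have [/xs/bound/andP[b1 b2]|/(tent_out h0) ->] := boolP (s < r < s + 2 * h).
      by rewrite -mulrN ler_wpM2l ?tent_ge0//; lra.
    by rewrite !mul0r oppr0.
  have Et : tent t h r * inner (x r) p <=
      tent t h r * (inner (x t) p + e * `|p|).
    have [/xt/bound/andP[b1 b2]|/(tent_out h0) ->] := boolP (t < r < t + 2 * h).
      by rewrite ler_wpM2l ?tent_ge0//; lra.
    by rewrite !mul0r.
  by lra.
(* Second reading, through [v]: the test function is bounded by 1 and vanishes off ]s, t + 2 h]. *)
have B : inner (- w) (- p) <=
    (\int[mu]_(r in `]s, t]) g r + \int[mu]_(r in `]t, t + 2 * h]) g r) * `|p|.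
  rewrite -Rintegral_itv_cat//; [|exact: ltW|lra].
  rewrite -RintegralZr//; last exact: igA.
  have sub : `]s, t + 2 * h] `<=` `]a, b[.
    by move=> r; rewrite /= !in_itv/= => /andP[? ?]; apply/andP; split; lra.
  rewrite -(setIidr sub) Rintegral_mkcondr.
  have mDI : measurable (`]a, b[ `&` `]s, t + 2 * h] : set R).
    exact: measurableI.
  have iH : mu.-integrable `]a, b[
      (EFin \o ((fun r => g r * `|p|) \_ `]s, t + 2 * h])).
    rewrite -restrict_EFin.
    apply/(@integrable_restrict _ _ _ mu _ (measurable_itv _) _ mD).
    have := @integrableZr _ _ _ mu _ mDI `|p| _ (igA _ mDI).
    by apply: eq_integrable.
  apply: (inner_bochner_le mD bNw iH).
  apply: filterS vg0 => r + Dr => /(_ Dr) vr.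
  have phir : `|smooth_step s h r - smooth_step t h r| <= 1.
    have /andP[? ?] := smooth_step_itv s h r.
    have /andP[? ?] := smooth_step_itv t h r.
    by rewrite ler_norml; apply/andP; split; lra.
  rewrite patchE; case: ifPn => [rs|].
    rewrite innerZl innerNr.
    rewrite (le_trans (ler_norm _))// normrM normrN.
    rewrite (le_trans (ler_wpM2r (normr_ge0 _) phir))// mul1r.
    rewrite (le_trans (normr_inner_le _ _))// ler_wpM2r//.
    by rewrite /g patchE mem_set.
  rewrite notin_setE/= in_itv/= => /negP; rewrite negb_and -leNgt -ltNge.
  move=> /orP[rs|tr].
    by rewrite !smooth_step_le ?subrr ?scale0r ?inner0l//; lra.
  by rewrite !smooth_step_ge ?subrr ?scale0r ?inner0l//; lra.
rewrite innerNl in B; have -> : e3 = 3 * e by rewrite /e mulrC divfK.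
exact: increment_arith A B gh p0.
Unshelve. all: by end_near. Qed.

End W11_increment.

(** * Decay of strong solutions *)

Section nonincreasing.
Variable R : realType.
Local Notation mu := (@lebesgue_measure R).

(** At the supremum [c] of the points up to which [Q] holds, the limit hypothesis yields [Q c], and
    then the step hypothesis excludes c < b. *)
Lemma real_induction (a b : R) (Q : R -> Prop) : a <= b -> Q a ->
  (forall t, a <= t -> t < b -> Q t ->
    exists2 d, 0 < d & forall s, t < s -> s < t + d -> s <= b -> Q s) ->
  (forall t, a < t -> t <= b -> (forall s, a <= s -> s < t -> Q s) -> Q t) ->
  Q b.
Proof.
move=> ab Qa Qstep Qlim.
pose A := [set t | a <= t <= b /\ forall s, a <= s -> s <= t -> Q s].
have Aa : A a.
  split; first by rewrite lexx.
  by move=> s as_ sa; have -> : s = a by apply/eqP; rewrite eq_le sa.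
have supA : has_sup A by split; [exists a|exists b => t [/andP[]]].
pose c := sup A.
have ac : a <= c by exact: sup_upper_bound.
have cb : c <= b by apply: ge_sup; [exists a|move=> t [/andP[]]].
have Qc_ s : a <= s -> s < c -> Q s.
  move=> as_ sc; have sc0 : 0 < c - s by rewrite subr_gt0.
  have [t [_ Qt]] := sup_adherent sc0 supA; rewrite -/c subKr => st.
  by apply: Qt => //; exact: ltW.
have Qc : Q c.
  have [ac'|ca] := ltP a c; first exact: Qlim.
  by have <- : a = c by apply/eqP; rewrite eq_le ac.
have [cb'|bc] := ltP c b; last by have <- : c = b by apply/eqP; rewrite eq_le cb.
have [d d0 Qd] := Qstep c ac cb' Qc.
pose t := Num.min (c + d / 2) b.
have ct : c < t by rewrite lt_min cb' andbT ltrDl divr_gt0.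
have td : t < c + d by rewrite gt_min; apply/orP; left; rewrite ltrD2l; lra.
have tb : t <= b by rewrite ge_min lexx orbT.
suff /(sup_upper_bound supA) : A t by rewrite -/c leNgt ct.
split; first by rewrite tb (le_trans ac)// ltW.
move=> s as_ st; have [sc|] := ltP s c; first exact: Qc_.
rewrite le_eqVlt => /predU1P[<- //|cs].
by apply: Qd => //; [exact: le_lt_trans td|exact: le_trans tb].
Qed.

Lemma Rintegral_itv_ge0 (k : R -> R) s t : (forall r, 0 <= k r) ->
  0 <= \int[mu]_(r in `]s, t]) k r.
Proof. by move=> k0; exact: Rintegral_ge0. Qed.

(* The null set of bad points is put in an open set [O] with small [k]-mass;
   inside [O] the increments of [phi] are charged to that mass. *)
Lemma ae_derive_le0_nonincreasing (phi k : R -> R) (a b : R) : a <= b ->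
  mu.-integrable [set: R] (EFin \o k) -> (forall r, 0 <= k r) ->
  (forall r, a <= r <= b -> {for r, continuous phi}) ->
  (forall s t, a <= s -> s <= t -> t <= b ->
    phi t - phi s <= \int[mu]_(r in `]s, t]) k r) ->
  {ae mu, forall r, r \in `]a, b[ ->
    exists2 l, is_derive r (1 : R) phi l & l <= 0} ->
  phi b <= phi a.
Proof.
move=> ab ik k0 cphi phik [N [mN N0 phiN]].
suff main e : 0 < e -> phi b - phi a <= e * (b - a) + e.
  rewrite -subr_le0; apply/ler_addgt0Pr => e e0; rewrite add0r.
  have ba1 : 0 < b - a + 1 by rewrite ltr_wpDl// subr_ge0.
  (* Rescaling makes the two error terms add up to [e]. *)
  have := main (e / (b - a + 1)) (divr_gt0 e0 ba1).
  by rewrite -{2}[e / _]mulr1 -mulrDr divfK ?gt_eqF.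
move=> e0; have [d [d0 kd]] := integral_normr_continuous ik e0.
(* The point [a] joins the null set because the induction starts there, while the derivative is
   controlled only on the open interval. *)
have mN' : measurable (N `|` [set a]) by exact: measurableU.
have N'0 : mu (N `|` [set a]) = 0%E.
  by rewrite measureU0//; exact: lebesgue_measure_set1.
have N'oo : (mu (N `|` [set a]) < +oo)%E by rewrite [ltLHS]N'0.
have [ O [oO NO Od]] := lebesgue_regularity_outer mN' N'oo d0.
have mO : measurable O by exact: open_measurable.
have muO : (mu O < d%:E)%E.
  apply: le_lt_trans Od.
  have mOD : measurable (O `\` (N `|` [set a])) by exact: measurableD.
  rewrite -(@measureU0 _ _ _ mu _ _ mOD mN' N'0) le_measure ?inE//; first exact: measurableU.
  by move=> r Or; have [Nr|Nr] := pselect ((N `|` [set a]) r); [right|left].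
pose kO := k \_ O.
have ikO : mu.-integrable [set: R] (EFin \o kO).
  rewrite -restrict_EFin.
  apply/(@integrable_restrict _ _ _ mu _ mO _ measurableT).
  by rewrite setTI; exact: (@integrableS _ _ _ mu setT).
have kO0 r : 0 <= kO r by rewrite /kO patchE; case: ifP.
pose I t := \int[mu]_(r in `]a, t]) kO r.
have Iab : I b <= e.
  rewrite /I /kO -Rintegral_mkcondr.
  have mI : measurable (`]a, b] `&` O : set R) by exact: measurableI.
  apply/ltW; apply: le_lt_trans (kd _ mI _); last first.
    by apply: le_lt_trans muO; rewrite le_measure ?inE.
  rewrite (le_trans (ler_norm _))// le_normr_Rintegral//.
  exact: (@integrableS _ _ _ mu setT).
suff : phi b - phi a <= e * (b - a) + I b.
  by move=> /le_trans; apply; rewrite lerD2l.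
(* Invariant: slope [e] pays for steps from points outside [O], the mass of [k] on [O] for steps
   from points inside. *)
apply: (@real_induction a b (fun t => phi t - phi a <= e * (t - a) + I t)) => //.
- by rewrite !subrr mulr0 add0r /I Rintegral_itv_ge0.
- move=> t at_ tb Qt.
  have Icat s : t <= s -> I s = I t + \int[mu]_(r in `]t, s]) kO r.
    by move=> ts; exact: Rintegral_itv_cat.
  have [Ot|nOt] := pselect (O t).
    have /nbhs_ballP[h /= h0 hO] : nbhs t O by exact: open_nbhs_nbhs.
    exists h => // s ts sh sb; rewrite (Icat _ (ltW ts)).
    have <- : \int[mu]_(r in `]t, s]) k r = \int[mu]_(r in `]t, s]) kO r.
      apply: eq_Rintegral => r; rewrite inE/= in_itv/= => /andP[tr rs].
      rewrite /kO patchE mem_set//; apply: hO.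
      by rewrite /ball/= distrC ger0_norm ?subr_ge0 ?(ltW tr)//; lra.
    have := phik _ _ at_ (ltW ts) sb.
    have : e * (t - a) <= e * (s - a) by rewrite ler_wpM2l ?(ltW e0)//; lra.
    lra.
  have nNt : ~ (N `|` [set a]) t by move=> /NO.
  have tab : t \in `]a, b[.
    rewrite in_itv/= tb andbT lt_neqAle at_ andbT; apply/eqP => ta.
    by apply: nNt; right; rewrite ta.
  have [l dl l0] : exists2 l, is_derive t (1 : R) phi l & l <= 0.
    apply: contrapT => h; apply: nNt; left; apply: phiN => /=; apply: contra_not h.
    exact.
  (* The derivative is at most 0 here, so difference quotients stay below [e] on a short interval to
     the right. *)
  move: dl => /is_derive_cvgP/cvgrPdist_lt/(_ _ e0)/nbhs_ballP[h /= h0 hP].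
  exists h => // s ts sh sb; rewrite (Icat _ (ltW ts)).
  have st0 : 0 < s - t by rewrite subr_gt0.
  have := hP (s - t); rewrite /ball/= sub0r normrN gtr0_norm//.
  move=> /(_ ltac:(lra) ltac:(by rewrite gt_eqF)) /=.
  have scaleE (u v : R) : u *: (v : R^o) = u * v by [].
  rewrite !scaleE mulr1 subrK ltr_norml => /andP[q _].
  have : phi s - phi t <= e * (s - t).
    rewrite -ler_pdivrMr// mulrC; lra.
  by have := @Rintegral_itv_ge0 kO t s kO0; lra.
- move=> t at_ tb Qs.
  have cphit : phi s - phi a @[s --> t^'-] --> phi t - phi a.
    apply: cvgB; last exact: cvg_cst.
    by apply: cvg_at_left_filter; apply: cphi; rewrite (ltW at_).
  apply: (cvgr_to_le cphit); near=> s.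
  have st : s < t by near: s; exact: nbhs_left_lt.
  have as_ : a <= s by near: s; exact: nbhs_left_ge.
  apply: le_trans (Qs s as_ st) _; apply: lerD.
    by rewrite ler_wpM2l ?(ltW e0)// lerD2r ltW.
  rewrite /I (Rintegral_itv_cat ikO as_ (ltW st)) lerDl.
  exact: Rintegral_itv_ge0.
Unshelve. all: by end_near. Qed.

End nonincreasing.

(** * Exponential decay from a dissipation inequality *)

Section decay.
Variables (R : realType) (X : hilbertType R).
Local Notation mu := (@lebesgue_measure R).

(** The difference quotient factors through |a|^2 - |b|^2 = <a - b, a + b>. *)
Lemma is_derive_norm_sqr (y : R -> X) t v : is_derive t (1 : R) y v ->
  is_derive t (1 : R) (fun r => `|y r| ^+ 2) (2 * inner (y t) v).
Proof.
move=> yv; have dy : derivable y t 1 by case: yv.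
have cy : {for t, continuous y}.
  by apply: differentiable_continuous; exact/derivable1_diffP.
move/is_derive_cvgP : yv => qy.
have sy : (y \o shift t) (h *: (1 : R)) @[h --> 0^'] --> y t.
  have hs : (fun h : R => h * 1 + t) @ 0^' --> (0 * 1 + t : R).
    apply: cvgD; last exact: cvg_cst.
    by apply: cvgM; [exact: cvg_within|exact: cvg_cst].
  by rewrite mul0r add0r in hs; exact: (cvg_comp _ _ hs cy).
apply/is_derive_cvgP.
have qE : (fun h : R => h^-1 *: (((fun r => `|y r| ^+ 2) \o shift t)
    (h *: (1 : R)) - `|y t| ^+ 2) : R) = (fun h => inner (h^-1 *: ((y \o shift t) (h *: (1 : R)) - y t))
    ((y \o shift t) (h *: (1 : R)) + y t)).
  apply/funext => h /=.
  rewrite innerZl innerBl !innerDr !innerxx [inner (y t) (y _)]innerC.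
  by congr (_ * _); ring.
have -> : 2 * inner (y t) v = inner (y t + y t) v by rewrite innerDl; ring.
rewrite innerC qE.
by apply: cvg_inner; [exact: qy|apply: cvgD; [exact: sy|exact: cvg_cst]].
Qed.

Variables (T c : R) (xbar : X) (x : R -> X).
Hypothesis c0 : 0 < c.
Hypothesis cx : {within `[0, T], continuous x}.
Hypothesis wx : W11_left_open T x.
Hypothesis dx : {ae mu, forall t, t \in `]0, T[ -> exists2 v,
  is_derive t (1 : R) x v & inner (x t - xbar) v <= - c * `|x t - xbar| ^+ 2}.

(** The weight balances the dissipation: its derivative contributes 2 c |x - xbar|^2, which 2 <x -
    xbar, x'> compensates. *)
Let phi (r : R) := expR (2 * c * r) * `|x r - xbar| ^+ 2.

Let phi_nonincreasing s t : 0 < s -> s <= t -> t < T -> phi t <= phi s.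
Proof.
move=> s0 st tT.
have T0 : 0 < T by lra.
have /(continuous_within_itvP _ T0)[cxo _ _] := cx.
(* The weak derivative is integrable only away from 0; starting at s / 2 puts [s] strictly
   inside. *)
have s2T : 0 < s / 2 < T by apply/andP; split; lra.
have [|g [ig g0 xg]] := W11_increment (wx.2 _ s2T).
  move=> r; rewrite in_itv/= => /andP[sr rT]; apply: cxo.
  by rewrite in_itv/= rT andbT; lra.
have cxr r : s <= r <= t -> {for r, continuous x}.
  by move=> /andP[? ?]; apply: cxo; rewrite in_itv/=; apply/andP; split; lra.
have [m [m0 xm]] : exists m, 0 <= m /\
    forall r, s <= r -> r <= t -> `|x r - xbar| <= m.
  have [|z _ zm] := @EVT_max _ (fun r => `|x r - xbar|) _ _ st.
    apply: continuous_in_subspaceT => r; rewrite inE/= in_itv/= => /cxr cr.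
    by apply: cvg_norm; apply: cvgB; [exact: cr|exact: cvg_cst].
  exists `|x z - xbar|; split => // r sr rt.
  by apply: zm; rewrite in_itv/= sr.
pose E := expR (2 * c * t); have E0 : 0 < E by exact: expR_gt0.
(* [K1] covers increments of the squared norm, whose two factors are a sum at most 2 m and a
   difference bounded by the integral of [g]. [K2] is m^2 times a Lipschitz constant of the
   weight. *)
pose K1 := E * (2 * m); pose K2 := E * (2 * c) * m ^+ 2.
have K10 : 0 <= K1 by rewrite mulr_ge0 ?(ltW E0)// mulr_ge0.
have K20 : 0 <= K2.
  by rewrite mulr_ge0 ?exprn_ge0// mulr_ge0 ?(ltW E0)// mulr_ge0// ltW.
pose k r := K1 * g r + K2 * \1_(`]s, t]%classic : set R) r.
have ig' : mu.-integrable [set: R] (EFin \o (fun r => K1 * g r)).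
  exact: (@integrableZl _ _ _ mu _ measurableT K1 _ ig).
have i0 : mu.-integrable [set: R] (EFin \o \1_(`]s, t]%classic : set R)).
  exact: (integrable_indic_itv s t false false).
have i1 : mu.-integrable [set: R]
    (EFin \o (fun r => K2 * \1_(`]s, t]%classic : set R) r)).
  exact: (@integrableZl _ _ _ mu _ measurableT K2 _ i0).
have ik : mu.-integrable [set: R] (EFin \o k).
  exact: (@integrableD _ _ _ mu _ measurableT _ _ ig' i1).
apply: (@ae_derive_le0_nonincreasing _ phi k s t) => //.
- by move=> r; rewrite addr_ge0// mulr_ge0.
- move=> r rst; apply: cvgM.
    apply: (@continuous_comp R R R (fun r => 2 * c * r) expR r).
      by apply: cvgM; [exact: cvg_cst|exact: cvg_id].
    exact: continuous_expR.
  have cr : `|x q - xbar| @[q --> r] --> `|x r - xbar|.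
    by apply: cvg_norm; apply: cvgB; [exact: cxr|exact: cvg_cst].
  by rewrite expr2; under eq_fun do rewrite expr2; exact: cvgM.
- move=> p q sp pq qt.
  have mpq : measurable (`]p, q]%classic : set R) by [].
  have iA (f : R -> R) (hf : mu.-integrable [set: R] (EFin \o f)) :
      mu.-integrable `]p, q] (EFin \o f).
    exact: (@integrableS _ _ _ mu setT _ _ measurableT mpq (@subsetT _ _) hf).
  rewrite /k (@RintegralD _ _ _ mu _ _ _ mpq (iA _ ig') (iA _ i1)).
  rewrite (@RintegralZl _ _ _ mu _ _ K1 mpq (iA _ ig)).
  have mupq : fine (mu `]p, q]) = q - p.
    rewrite lebesgue_measure_itv/= lte_fin.
    by case: ltP => [//|qp] /=; lra.
  have -> : \int[mu]_(r in `]p, q]) (K2 * \1_(`]s, t]%classic : set R) r) =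
      K2 * (q - p).
    rewrite (@RintegralZl _ _ _ mu _ _ K2 mpq (iA _ i0)).
    rewrite /Rintegral integral_indic// setIidr; last first.
      by apply: subset_itv; rewrite bnd_simp.
    by congr (_ * _); exact: mupq.
  have pt : p <= t by exact: le_trans qt.
  have sq : s <= q by exact: le_trans pq.
  have hq := xm _ sq qt; have hp := xm _ sp pt.
  have xpq := xg p q ltac:(lra) pq ltac:(lra).
  have dnorm : `|x q - xbar| - `|x p - xbar| <= `|x q - x p|.
    rewrite lerBlDr (le_trans _ (ler_normD _ _))//.
    by rewrite addrA subrK.
  have h1 : `|x q - xbar| ^+ 2 - `|x p - xbar| ^+ 2 <=
      2 * m * \int[mu]_(r in `]p, q]) g r.
    rewrite subr_sqr mulrC.
    have s2 : `|x q - xbar| + `|x p - xbar| <= 2 * m by lra.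
    rewrite (@le_trans _ _ ((`|x q - xbar| + `|x p - xbar|) * `|x q - x p|))//.
      by rewrite ler_wpM2l ?addr_ge0.
    by rewrite ler_pM// addr_ge0.
  have eqE : expR (2 * c * q) <= E.
    by rewrite ler_expR ler_wpM2l// mulr_ge0// ltW.
  have h2 : expR (2 * c * q) - expR (2 * c * p) <= E * (2 * c) * (q - p).
    (* Convexity: 1 + z <= e^z at z = 2 c (p - q), multiplied by e^(2 c q). *)
    have := expR_ge1Dx (2 * c * p - 2 * c * q).
    rewrite -(ler_pM2l (expR_gt0 (2 * c * q))) -expRD subrKC => h.
    have : expR (2 * c * q) * (2 * c * (q - p)) <= E * (2 * c * (q - p)).
      by rewrite ler_wpM2r// mulr_ge0 ?subr_ge0// mulr_ge0// ltW.
    by lra.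
  have -> : phi q - phi p =
    expR (2 * c * q) * (`|x q - xbar| ^+ 2 - `|x p - xbar| ^+ 2) +
    (expR (2 * c * q) - expR (2 * c * p)) * `|x p - xbar| ^+ 2.
    by rewrite /phi; ring.
  have Ig0 : 0 <= \int[mu]_(r in `]p, q]) g r by exact: Rintegral_ge0.
  apply: lerD.
    rewrite (@le_trans _ _ (expR (2 * c * q) * (2 * m * \int[mu]_(r in `]p, q]) g r)))//.
      by rewrite ler_wpM2l ?expR_ge0.
    by rewrite /K1 -[leRHS]mulrA ler_wpM2r// mulr_ge0// mulr_ge0.
  have -> : K2 * (q - p) = E * (2 * c) * (q - p) * m ^+ 2 by rewrite /K2; ring.
  rewrite ler_pM ?sqr_ge0//.
    by rewrite subr_ge0 ler_expR ler_wpM2l// mulr_ge0// ltW.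
  by rewrite ler_pXn2r// nnegrE.
- apply: filterS dx => r + rst; case.
    move: rst; rewrite !in_itv/= => /andP[sr rt]; apply/andP; split; lra.
  move=> v dv dle.
  exists (expR (2 * c * r) * (2 * c * `|x r - xbar| ^+ 2 +
     2 * inner (x r - xbar) v)); last first.
    rewrite pmulr_rle0 ?expR_gt0//; lra.
  have d1 : is_derive r (1 : R) (fun r => x r - xbar) v.
    by have := is_deriveB dv (is_derive_cst xbar r (1 : R)); rewrite subr0.
  have d2 := is_derive_norm_sqr d1.
  have d3 : is_derive r (1 : R) (fun r => expR (2 * c * r))
      (2 * c * expR (2 * c * r)).
    have dl : is_derive r (1 : R) (fun r : R => 2 * c * r) (2 * c).
      have := is_deriveZ (2 * c) (is_derive_id r (1 : R)).
      by rewrite [_ *: 1]mulr1.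
    apply: is_derive_eq (is_derive1_comp (is_derive_expR (2 * c * r)) dl) _.
    by first [exact: mulrC|done].
  have := is_deriveM d3 d2; rewrite /GRing.scale/= => h.
  apply: is_derive_eq h _; ring.
Qed.

(** Monotonicity holds from positive times; right continuity at 0 brings in the initial value, and
    the square root halves the rate 2 c. *)
Lemma exp_decay t : 0 <= t -> t < T ->
  `|x t - xbar| <= expR (- c * t) * `|x 0 - xbar|.
Proof.
rewrite le_eqVlt => /predU1P[<- _|t0 tT].
  by rewrite mulr0 expR0 mul1r.
have T0 : 0 < T by lra.
have /(continuous_within_itvP _ T0)[_ cx0 _] := cx.
have c1 : phi s @[s --> 0^'+] --> phi 0.
  apply: cvgM.
    apply: cvg_at_right_filter.
    apply: (@continuous_comp R R R (fun r => 2 * c * r) expR 0).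
      by apply: cvgM; [exact: cvg_cst|exact: cvg_id].
    exact: continuous_expR.
  have cr : `|x q - xbar| @[q --> 0^'+] --> `|x 0 - xbar|.
    by apply: cvg_norm; apply: cvgB; [exact: cx0|exact: cvg_cst].
  by rewrite expr2; under eq_fun do rewrite expr2; exact: cvgM.
have : phi t <= phi 0.
  apply: (cvgr_to_ge c1); near=> s.
  have s0 : 0 < s by near: s; exact: nbhs_right_gt.
  have st : s <= t by near: s; exact: nbhs_right_ltW.
  exact: phi_nonincreasing.
rewrite /phi mulr0 expR0 mul1r => h.
rewrite -(ler_pXn2r (_ : (0 < 2)%N))// ?nnegrE ?mulr_ge0 ?expR_ge0//.
have eE : expR (2 * c * t) * expR (- c * t) ^+ 2 = 1.
  by rewrite expr2 -!expRD -[RHS]expR0; congr expR; ring.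
rewrite exprMn -[leLHS]mul1r -eE [_ * expR _ ^+ 2]mulrC -[leLHS]mulrA.
by rewrite ler_wpM2l// exprn_ge0// expR_ge0.
Unshelve. all: by end_near. Qed.

End decay.

(** * Hilbert products and blocks *)

Section hprod_theory.
Variables (R : realType) (X Y : hilbertType R).
Local Notation mu := (@lebesgue_measure R).
Local Notation XY := (hprod X Y).

Definition hprod_inl (a : X) : XY := (a, 0).
Definition hprod_inr (b : Y) : XY := (0, b).

Lemma hprod_innerE (x y : XY) : inner x y = inner x.1 y.1 + inner x.2 y.2.
Proof. by []. Qed.

Lemma norm_hprod_inl a : `|hprod_inl a| = `|a|.
Proof. by rewrite hprod_normE/= normr0 expr0n addr0 sqrtr_sqr normr_id. Qed.

Lemma norm_hprod_inr b : `|hprod_inr b| = `|b|.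
Proof. by rewrite hprod_normE/= normr0 expr0n add0r sqrtr_sqr normr_id. Qed.

Lemma hprod_inl_linear : linear hprod_inl.
Proof. by move=> a x y; congr (_, _); rewrite /= scaler0 addr0. Qed.

Lemma hprod_inr_linear : linear hprod_inr.
Proof. by move=> a x y; congr (_, _); rewrite /= scaler0 addr0. Qed.

Lemma hprod_split (x : XY) : x = hprod_inl x.1 + hprod_inr x.2.
Proof. by case: x => a b; congr (_, _); rewrite /= ?addr0 ?add0r. Qed.

Lemma hprod_fst_linear : linear (fun x : XY => x.1).
Proof. by []. Qed.

Lemma hprod_snd_linear : linear (fun x : XY => x.2).
Proof. by []. Qed.

Lemma hprod_fst_bounded : bounded_linear (fun x : XY => x.1).
Proof.
split; first exact: hprod_fst_linear.
by exists 1 => x; rewrite mul1r; exact: hprod_norm_fst.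
Qed.

Lemma hprod_snd_bounded : bounded_linear (fun x : XY => x.2).
Proof.
split; first exact: hprod_snd_linear.
by exists 1 => x; rewrite mul1r; exact: hprod_norm_snd.
Qed.

Lemma hprod_inl_bounded : bounded_linear hprod_inl.
Proof.
split; first exact: hprod_inl_linear.
by exists 1 => x; rewrite mul1r norm_hprod_inl.
Qed.

Lemma hprod_inr_bounded : bounded_linear hprod_inr.
Proof.
split; first exact: hprod_inr_linear.
by exists 1 => x; rewrite mul1r norm_hprod_inr.
Qed.

Lemma cvg_hprodP (T : Type) (G : set_system T) {FG : Filter G} (f : T -> XY) (l : XY) :
  f @ G --> l <-> (f t).1 @[t --> G] --> l.1 /\ (f t).2 @[t --> G] --> l.2.
Proof.
split=> [fl|[f1 f2]].
  by split; [exact: (bounded_linear_cvg hprod_fst_bounded)|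
             exact: (bounded_linear_cvg hprod_snd_bounded)].
rewrite (hprod_split l).
rewrite (_ : f = fun t => hprod_inl (f t).1 + hprod_inr (f t).2); last first.
  by apply/funext => t; exact: hprod_split.
by apply: cvgD; [exact: (bounded_linear_cvg hprod_inl_bounded)|
                 exact: (bounded_linear_cvg hprod_inr_bounded)].
Qed.

(** Projections and inclusions do not increase norms. Conversely the function is the sum of its two
    included coordinates, so the approximants may be chosen separately. *)
Lemma is_bochner_hprodP D (f : R -> XY) (w : XY) : measurable D ->
  is_bochner D f w <->
  is_bochner D (fun t => (f t).1) w.1 /\ is_bochner D (fun t => (f t).2) w.2.
Proof.
move=> mD; split=> [fw|[f1 f2]].
  split.
    by apply: (is_bochner_comp mD hprod_fst_linear) fw; exact: hprod_norm_fst.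
  by apply: (is_bochner_comp mD hprod_snd_linear) fw; exact: hprod_norm_snd.
rewrite (hprod_split w).
rewrite (_ : f = fun t => hprod_inl (f t).1 + hprod_inr (f t).2); last first.
  by apply/funext => t; exact: hprod_split.
apply: is_bochnerD => //.
  by apply: (is_bochner_comp mD hprod_inl_linear) f1 => a; rewrite norm_hprod_inl.
by apply: (is_bochner_comp mD hprod_inr_linear) f2 => a; rewrite norm_hprod_inr.
Qed.

Lemma bochner_integrable_hprodP D (f : R -> XY) : measurable D ->
  bochner_integrable D f <->
  bochner_integrable D (fun t => (f t).1) /\
  bochner_integrable D (fun t => (f t).2).
Proof.
move=> mD; split=> [[w /(is_bochner_hprodP _ _ mD)[f1 f2]]|[[w1 f1] [w2 f2]]].
  by split; [exists w.1|exists w.2].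
by exists ((w1, w2) : XY); apply/is_bochner_hprodP.
Qed.

Lemma weak_derivative_hprodP a b (x v : R -> XY) :
  weak_derivative a b x v <->
  weak_derivative a b (fun t => (x t).1) (fun t => (v t).1) /\
  weak_derivative a b (fun t => (x t).2) (fun t => (v t).2).
Proof.
have mD : measurable (`]a, b[ : set R) by [].
split=> [xv|[xv1 xv2] phi tphi].
  by split=> phi /xv[w /(is_bochner_hprodP _ _ mD)[x1 x2]
    /(is_bochner_hprodP _ _ mD)[v1 v2]]; [exists w.1|exists w.2].
have [w1 x1 v1] := xv1 _ tphi; have [w2 x2 v2] := xv2 _ tphi.
by exists ((w1, w2) : XY); apply/is_bochner_hprodP.
Qed.

Lemma W11_hprodP a b (x : R -> XY) : W11 a b x <->
  W11 a b (fun t => (x t).1) /\ W11 a b (fun t => (x t).2).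
Proof.
have mD : measurable (`]a, b[ : set R) by [].
split=> [[/(bochner_integrable_hprodP _ mD)[x1 x2]
    [v /(bochner_integrable_hprodP _ mD)[v1 v2]
    /weak_derivative_hprodP[d1 d2]]]|
    [[x1 [v1 i1 d1]] [x2 [v2 i2 d2]]]].
  by split; split => //; [exists (fun t => (v t).1)|exists (fun t => (v t).2)].
split; first exact/bochner_integrable_hprodP.
exists (fun t => (v1 t, v2 t) : XY); first exact/bochner_integrable_hprodP.
exact/weak_derivative_hprodP.
Qed.

Lemma W11_left_open_hprodP T (x : R -> XY) : W11_left_open T x <->
  W11_left_open T (fun t => (x t).1) /\ W11_left_open T (fun t => (x t).2).
Proof.
have mD : measurable (`]0, T[ : set R) by [].
split=> [[/(bochner_integrable_hprodP _ mD)[x1 x2] wx]|[[x1 w1] [x2 w2]]].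
  by split; split=> // d /wx/W11_hprodP[].
split; first exact/bochner_integrable_hprodP.
by move=> d dT; apply/W11_hprodP; split; [exact: w1|exact: w2].
Qed.

Lemma within_continuous_hprodP (A : set R) (x : R -> XY) :
  {within A, continuous x} <-> {within A, continuous (fun t => (x t).1)} /\
    {within A, continuous (fun t => (x t).2)}.
Proof.
split=> [cx|[c1 c2] t].
  by split=> t; have /cvg_hprodP[] := cx t.
by apply/cvg_hprodP; split; [exact: c1|exact: c2].
Qed.

Lemma is_derive_hprodP (x : R -> XY) (t : R) (v : XY) : is_derive t (1 : R) x v <->
  is_derive t (1 : R) (fun r => (x r).1) v.1 /\
  is_derive t (1 : R) (fun r => (x r).2) v.2.
Proof.
split=> [/is_derive_cvgP/cvg_hprodP[x1 x2]|[/is_derive_cvgP x1 /is_derive_cvgP x2]].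
  by split; exact/is_derive_cvgP.
by apply/is_derive_cvgP/cvg_hprodP.
Qed.

End hprod_theory.

Section block_theory.
Variables (R : realType) (X U1 U2 : hilbertType R) (B : hprod U1 U2 -> X).
Hypothesis bB : bounded_linear B.

Lemma block1_bounded_linear : bounded_linear (block1 B).
Proof.
have [k k0 kB] := bounded_linear_pos bB; split.
  by move=> a u v; rewrite /block1 -bB.1; congr B; exact: hprod_inl_linear.
exists k => u; have <- : `|(u, 0) : hprod U1 U2| = `|u| := norm_hprod_inl _ u.
exact: kB.
Qed.

Lemma block2_bounded_linear : bounded_linear (block2 B).
Proof.
have [k k0 kB] := bounded_linear_pos bB; split.
  by move=> a u v; rewrite /block2 -bB.1; congr B; exact: hprod_inr_linear.
exists k => u; have <- : `|(0, u) : hprod U1 U2| = `|u| := norm_hprod_inr _ u.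
exact: kB.
Qed.

Lemma blockE u1 u2 : B (u1, u2) = block1 B u1 + block2 B u2.
Proof.
have [_ BD _ _ _] := linearFE bB.1.
by rewrite /block1 /block2 -BD; congr B; exact: hprod_split.
Qed.

(** This separates the output used by the coupling from the external one. *)
Lemma adjoint_blockE x :
  adjoint B x = (adjoint (block1 B) x, adjoint (block2 B) x).
Proof.
apply: adjoint_unique => // -[u1 u2]; rewrite blockE innerDl.
by rewrite (adjointP block1_bounded_linear) (adjointP block2_bounded_linear).
Qed.

End block_theory.

(** * The interconnection *)

Lemma bounded_linear_comp (R : realType) (U V W : hilbertType R) (A : V -> W)
  (B : U -> V) : bounded_linear A -> bounded_linear B ->
  bounded_linear (fun u => A (B u)).
Proof.
move=> bA bB; have [k k0 kA] := bounded_linear_pos bA.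
have [l l0 lB] := bounded_linear_pos bB.
split; first by move=> a u v; rewrite bB.1 bA.1.
exists (k * l) => u; rewrite (le_trans (kA _))// -mulrA ler_wpM2l//.
exact: ltW.
Qed.

Section interconnection_theory.
Variables (R : realType) (X1 X2 U1 U2 : hilbertType R).
Variables (S1 : system X1 (hprod U1 U2)) (S2 : system X2 (hprod U1 U2)).
Variable F : U1 -> U1.
Hypotheses (hS1 : monotone_pHs S1) (hS2 : monotone_pHs S2).
Hypothesis hF : bounded_linear F.
Local Notation mu := (@lebesgue_measure R).
Local Notation X := (hprod X1 X2).
Local Notation S := (interconnection S1 S2 F).

Let b1 := block1 (sysB S1).
Let b2 := block1 (sysB S2).

Let bb1 : bounded_linear b1.
Proof. exact: block1_bounded_linear hS1.2. Qed.

Let bb2 : bounded_linear b2.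
Proof. exact: block1_bounded_linear hS2.2. Qed.

Let K12 (x : X2) : X1 := b1 (F (adjoint b2 x)).
Let K21 (x : X1) : X2 := b2 (adjoint F (adjoint b1 x)).

Let bK12 : bounded_linear K12.
Proof.
apply: (bounded_linear_comp bb1); apply: (bounded_linear_comp hF).
exact: adjoint_bounded_linear.
Qed.

Let bK21 : bounded_linear K21.
Proof.
apply: (bounded_linear_comp bb2).
by apply: bounded_linear_comp; exact: adjoint_bounded_linear.
Qed.

Let skewK x1 x2 : inner (K12 x2) x1 = inner (K21 x1) x2.
Proof. by rewrite /K12 /K21 (adjointP bb1) (adjointP hF) (adjointP bb2) innerC. Qed.

Lemma interconnectM_inner (x y : X) :
  inner (sysM S x - sysM S y) (x - y) =
  inner (sysM S1 x.1 - sysM S1 y.1) (x.1 - y.1) +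
  inner (sysM S2 x.2 - sysM S2 y.2) (x.2 - y.2).
Proof.
have [_ _ KB1 _ _] := linearFE bK12.1; have [_ _ KB2 _ _] := linearFE bK21.1.
rewrite hprod_innerE.
have -> : (sysM S x - sysM S y).1 =
    sysM S1 x.1 - sysM S1 y.1 - K12 (x.2 - y.2).
  rewrite KB1 -[LHS]/(sysM S1 x.1 - K12 x.2 - (sysM S1 y.1 - K12 y.2)).
  by rewrite !opprB addrCA [RHS]addrCA; congr (_ + _); exact: addrAC.
have -> : (sysM S x - sysM S y).2 =
    sysM S2 x.2 - sysM S2 y.2 + K21 (x.1 - y.1).
  rewrite KB2 -[LHS]/(sysM S2 x.2 + K21 x.1 - (sysM S2 y.2 + K21 y.1)).
  by rewrite opprD addrACA.
rewrite innerDl [inner (- K12 _) _]innerNl [inner (_ + K21 _) _]innerDl skewK.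
by rewrite addrACA addNr addr0.
Qed.

Lemma interconnection_monotone : monotone_pHs S.
Proof.
have [l1 k1] := block2_bounded_linear hS1.2.
have [l2 k2] := block2_bounded_linear hS2.2.
have [h1 h10 h1P] := bounded_linear_pos (block2_bounded_linear hS1.2).
have [h2 h20 h2P] := bounded_linear_pos (block2_bounded_linear hS2.2).
split.
  move=> x y [Dx1 Dx2] [Dy1 Dy2]; rewrite interconnectM_inner.
  by rewrite addr_ge0// ?hS1.1// hS2.1.
split; first by move=> a u v; congr (_, _); [exact: l1|exact: l2].
exists (h1 + h2) => u; rewrite (le_trans (hprod_norm_le _))//= mulrDl.
apply: lerD.
  by rewrite (le_trans (h1P _))// ler_wpM2l ?(ltW h10)//; exact: hprod_norm_fst.
by rewrite (le_trans (h2P _))// ler_wpM2l ?(ltW h20)//; exact: hprod_norm_snd.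
Qed.

Lemma adjoint_interconnectB (x : X) : adjoint (sysB S) x =
  (adjoint (block2 (sysB S1)) x.1, adjoint (block2 (sysB S2)) x.2).
Proof.
apply: adjoint_unique; first exact: interconnection_monotone.2.
move=> u; rewrite !hprod_innerE/=.
rewrite (adjointP (block2_bounded_linear hS1.2)).
by rewrite (adjointP (block2_bounded_linear hS2.2)).
Qed.

Lemma interconnection_m_accretive :
  m_accretive (sysM S1) -> m_accretive (sysM S2) -> m_accretive (sysM S).
Proof.
move=> [a1 [l1 l10 M1]] [a2 [l2 l20 M2]].
split; first exact: interconnection_monotone.1.
pose M0 : operator X := Operator
  [set x : X | opdom (sysM S1) x.1 /\ opdom (sysM S2) x.2]
  (fun x : X => (sysM S1 x.1, sysM S2 x.2)).
(* The operator is [M0 - G]: the diagonal part carries the range condition, [G] the coupling. *)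
pose G (x : X) : X := (K12 x.2, - K21 x.1).
have [_ _ KB1 _ _] := linearFE bK12.1; have [_ _ KB2 _ _] := linearFE bK21.1.
have [k1 k10 k1P] := bounded_linear_pos bK12.
have [k2 k20 k2P] := bounded_linear_pos bK21.
have aM0 : accretive M0.
  move=> x y [Dx1 Dx2] [Dy1 Dy2]; rewrite hprod_innerE/=.
  by rewrite addr_ge0// ?a1// a2.
have GL (x y : X) : `|G x - G y| <= (k1 + k2) * `|x - y|.
  rewrite (le_trans (hprod_norm_le _))//= mulrDl; apply: lerD.
    rewrite -KB1 (le_trans (k1P _))// ler_wpM2l ?(ltW k10)//.
    exact: (hprod_norm_snd (x - y)).
  rewrite -opprD normrN -KB2 (le_trans (k2P _))// ler_wpM2l ?(ltW k20)//.
  exact: (hprod_norm_fst (x - y)).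
(* One more than the Lipschitz constant of [G]; both range conditions are moved to this common
   parameter. *)
pose l := k1 + k2 + 1.
have kl : 0 <= k1 + k2 < l by rewrite addr_ge0 ?ltW//= /l ltrDl.
have l0 : 0 < l by case/andP: kl => /le_lt_trans; exact.
have M0l : range_full M0 l.
  move=> z.
  have [x1 D1 E1] := range_full_all a1 l10 l0 M1 z.1.
  have [x2 D2 E2] := range_full_all a2 l20 l0 M2 z.2.
  exists ((x1, x2) : X) => //.
  by rewrite [RHS]surjective_pairing -E1 -E2.
exists l => // z; have [x Dx xE] := range_full_perturb aM0 l0 kl GL M0l z.
exists x => //.
have -> : sysM S x = M0 x - G x by congr (_, _); rewrite /= ?opprK.
by rewrite addrA xE addrK.
Qed.

Lemma interconnection_strongly_accretive (xbar : X) :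
  strongly_accretive_at (sysM S1) xbar.1 ->
  strongly_accretive_at (sysM S2) xbar.2 -> strongly_accretive_at (sysM S) xbar.
Proof.
move=> [D1 [c1 c10 M1]] [D2 [c2 c20 M2]]; split => //.
(* Squared norms add in the product, so the smaller constant serves both components. *)
exists (Num.min c1 c2); first by rewrite lt_min c10.
move=> x [Dx1 Dx2]; rewrite innerC interconnectM_inner.
rewrite -innerxx [inner (x - xbar) _]hprod_innerE !innerxx mulrDr.
have m1 := M1 _ Dx1; have m2 := M2 _ Dx2.
apply: lerD; rewrite innerC.
  by apply: le_trans m1; rewrite ler_wpM2r ?exprn_ge0// ge_min lexx.
by apply: le_trans m2; rewrite ler_wpM2r ?exprn_ge0// ge_min lexx orbT.
Qed.

Lemma interconnection_rhs (x : X) (u : hprod U2 U2) :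
  - sysM S x + sysB S u =
  (- sysM S1 x.1 + sysB S1 (F (adjoint b2 x.2), u.1),
   - sysM S2 x.2 + sysB S2 (- adjoint F (adjoint b1 x.1), u.2)).
Proof.
have [_ _ _ bN _] := linearFE bb2.1.
rewrite (blockE hS1.2) (blockE hS2.2) -/b1 -/b2 bN.
rewrite -[LHS]/(- (sysM S1 x.1 - K12 x.2) + block2 (sysB S1) u.1,
  - (sysM S2 x.2 + K21 x.1) + block2 (sysB S2) u.2).
by congr (_, _); rewrite ?opprB ?opprD addrA //; congr (_ + _); rewrite addrC.
Qed.

(** Every clause of the solution concept splits along the product. The feedback law on [0, T]
    suffices because the equation is tested only inside that interval. *)
Lemma strong_solution_interconnection T (x0 : X) (x : R -> X)
    (u : R -> hprod U2 U2) (u1 u2 : R -> U1) :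
  (forall t, t \in `[0, T] -> u1 t = F (adjoint b2 (x t).2)) ->
  (forall t, t \in `[0, T] -> u2 t = - adjoint F (adjoint b1 (x t).1)) ->
  strong_solution S1 (fun t => (u1 t, (u t).1)) x0.1 T (fun t => (x t).1) /\
  strong_solution S2 (fun t => (u2 t, (u t).2)) x0.2 T (fun t => (x t).2) <->
  strong_solution S u x0 T x.
Proof.
move=> u1E u2E; have sub t : t \in `]0, T[ -> t \in `[0, T].
  by apply: subset_itv_oo_cc.
split=> [[[c1 w1 i1 d1] [c2 w2 i2 d2]]|[cx wx ix dx]].
  split.
  - exact/within_continuous_hprodP.
  - exact/W11_left_open_hprodP.
  - by rewrite [LHS]surjective_pairing i1 i2 -surjective_pairing.
  - apply: filterS2 d1 d2 => t + + tT => /(_ tT)[D1 d1] /(_ tT)[D2 d2].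
    split=> //; rewrite interconnection_rhs; apply/is_derive_hprodP => /=.
    by rewrite -u1E ?sub// -u2E ?sub.
move/within_continuous_hprodP : cx => [c1 c2].
move/W11_left_open_hprodP : wx => [w1 w2].
split; split => //; rewrite ?ix//.
  apply: filterS dx => t + tT => /(_ tT)[[D1 D2]].
  rewrite interconnection_rhs => /is_derive_hprodP[d1 _]; split => //.
  by rewrite u1E ?sub.
apply: filterS dx => t + tT => /(_ tT)[[D1 D2]].
rewrite interconnection_rhs => /is_derive_hprodP[_ d2]; split => //.
by rewrite u2E ?sub.
Qed.

Lemma trajectory_interconnection T (x0 : X) (x : R -> X)
    (u y : R -> hprod U2 U2) (u1 y1 u2 y2 : R -> U1) :
  trajectory S1 T x0.1 (fun t => (x t).1)
    (fun t => (u1 t, (u t).1)) (fun t => (y1 t, (y t).1)) ->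
  trajectory S2 T x0.2 (fun t => (x t).2)
    (fun t => (u2 t, (u t).2)) (fun t => (y2 t, (y t).2)) ->
  (forall t, t \in `[0, T] -> interconnected F (u1 t) (y1 t) (u2 t) (y2 t)) ->
  trajectory S T x0 x u y.
Proof.
move=> [s1 y1E] [s2 y2E] hI.
have e1 t : t \in `[0, T] ->
    y1 t = adjoint b1 (x t).1 /\ (y t).1 = adjoint (block2 (sysB S1)) (x t).1.
  by move=> /y1E; rewrite (adjoint_blockE hS1.2) => -[].
have e2 t : t \in `[0, T] ->
    y2 t = adjoint b2 (x t).2 /\ (y t).2 = adjoint (block2 (sysB S2)) (x t).2.
  by move=> /y2E; rewrite (adjoint_blockE hS2.2) => -[].
split.
  apply/(@strong_solution_interconnection _ _ _ _ u1 u2) => // t tT.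
    by rewrite (hI t tT).1 (e2 t tT).1.
  by rewrite (hI t tT).2 (e1 t tT).1.
move=> t tT; rewrite adjoint_interconnectB -(e1 t tT).2 -(e2 t tT).2.
exact: surjective_pairing.
Qed.

(** The internal signals are recovered from the state by feedback formulas free of [T], so one
    choice serves all horizons. *)
Lemma interconnection_trajectory T (x0 : X) (x : R -> X)
    (u y : R -> hprod U2 U2) : trajectory S T x0 x u y ->
  trajectory S1 T x0.1 (fun t => (x t).1)
    (fun t => (F (adjoint b2 (x t).2), (u t).1))
    (fun t => (adjoint b1 (x t).1, (y t).1)) /\
  trajectory S2 T x0.2 (fun t => (x t).2)
    (fun t => (- adjoint F (adjoint b1 (x t).1), (u t).2))
    (fun t => (adjoint b2 (x t).2, (y t).2)).
Proof.
move=> [sx yE].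
have [s1 s2] := (@strong_solution_interconnection T x0 x u
  (fun t => F (adjoint b2 (x t).2)) (fun t => - adjoint F (adjoint b1 (x t).1))
  (fun _ _ => erefl) (fun _ _ => erefl)).2 sx.
split; split => // t tT; rewrite (yE t tT) adjoint_interconnectB.
  by rewrite (adjoint_blockE hS1.2).
by rewrite (adjoint_blockE hS2.2).
Qed.

Lemma interconnection_exp_decay (xbar : X) :
  strongly_accretive_at (sysM S) xbar -> sysM S xbar = 0 ->
  exists2 c, 0 < c & forall (x0 : X) (x : R -> X),
    strong_solution_infty S (fun=> 0) x0 x -> forall t, 0 <= t ->
    `|x t - xbar| <= expR (- c * t) * `|x0 - xbar|.
Proof.
move=> [Dxbar [c c0 Mc]] Mxbar; exists c => // x0 x sx t t0.
(* The decay estimate asks for [t] strictly before the horizon. *)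
have [cx wx <- dx] := sx (t + 1) (ltr_wpDl t0 ltr01).
apply: (exp_decay c0 cx wx) => //; last by rewrite ltrDl.
apply: filterS dx => r + rT => /(_ rT)[Dr dr].
exists (- sysM S (x r) + sysB S 0) => //.
have [-> _ _ _ _] := linearFE interconnection_monotone.2.1.
(* As [M] vanishes at [xbar], strong accretivity bounds <x - xbar, - M x> itself by - c |x -
   xbar|^2. *)
by have := Mc _ Dr; rewrite Mxbar subr0 addr0 innerNr mulNr lerN2.
Qed.

End interconnection_theory.

Theorem proposition2p6 (R : realType) (X1 X2 U1 U2 : hilbertType R)
    (S1 : system X1 (hprod U1 U2)) (S2 : system X2 (hprod U1 U2))
    (F : U1 -> U1)
    (hS1 : monotone_pHs S1) (hS2 : monotone_pHs S2) (hF : bounded_linear F) :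
  let S := interconnection S1 S2 F in
  [/\ (* the interconnected trajectories of S1 and S2 are those of S *)
      (forall (T : R) (x0 : hprod X1 X2) (x : R -> hprod X1 X2)
          (u y : R -> hprod U2 U2), 0 < T ->
        (exists u1 y1 u2 y2 : R -> U1, [/\
          trajectory S1 T x0.1 (fun t => (x t).1)
            (fun t => (u1 t, (u t).1)) (fun t => (y1 t, (y t).1)),
          trajectory S2 T x0.2 (fun t => (x t).2)
            (fun t => (u2 t, (u t).2)) (fun t => (y2 t, (y t).2)) &
          forall t, t \in `[0, T] ->
            interconnected F (u1 t) (y1 t) (u2 t) (y2 t)])
        <-> trajectory S T x0 x u y) /\
      (forall (x0 : hprod X1 X2) (x : R -> hprod X1 X2)
          (u y : R -> hprod U2 U2),
        (exists u1 y1 u2 y2 : R -> U1, [/\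
          trajectory_infty S1 x0.1 (fun t => (x t).1)
            (fun t => (u1 t, (u t).1)) (fun t => (y1 t, (y t).1)),
          trajectory_infty S2 x0.2 (fun t => (x t).2)
            (fun t => (u2 t, (u t).2)) (fun t => (y2 t, (y t).2)) &
          forall t, 0 <= t ->
            interconnected F (u1 t) (y1 t) (u2 t) (y2 t)])
        <-> trajectory_infty S x0 x u y),
      monotone_pHs S /\
      (forall x : hprod X1 X2, adjoint (sysB S) x =
        (adjoint (block2 (sysB S1)) x.1, adjoint (block2 (sysB S2)) x.2)),
      maximally_monotone_pHs S1 -> maximally_monotone_pHs S2 ->
        maximally_monotone_pHs S,
      forall xbar : hprod X1 X2,
        strongly_accretive_at (sysM S1) xbar.1 ->
        strongly_accretive_at (sysM S2) xbar.2 ->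
        strongly_accretive_at (sysM S) xbar &
      forall xbar : hprod X1 X2,
        strongly_accretive_at (sysM S1) xbar.1 ->
        strongly_accretive_at (sysM S2) xbar.2 ->
        (* xbar is an equilibrium for zero input *)
        sysM S xbar = 0 ->
        exists C omega : R, [/\ 0 < C, 0 < omega &
          forall (x0 : hprod X1 X2) (x : R -> hprod X1 X2),
            strong_solution_infty S (fun=> 0) x0 x ->
            forall t, 0 <= t ->
              `|x t - xbar|
                <= C * expR (- omega * t) * `|x0 - xbar|]].
Proof.
move=> S; split.
- split=> [T x0 x u y T0|x0 x u y].
    split=> [[u1 [y1 [u2 [y2 [t1 t2 hI]]]]]|].
      exact: (trajectory_interconnection hS1 hS2 hF t1 t2 hI).
    move=> /(interconnection_trajectory hS1 hS2 hF)[t1 t2].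
    by do 4 eexists; split; [exact: t1|exact: t2|].
  split=> [[u1 [y1 [u2 [y2 [t1 t2 hI]]]]] T T0|tx].
    apply: (trajectory_interconnection hS1 hS2 hF (t1 T T0) (t2 T T0)).
    by move=> t; rewrite in_itv/= => /andP[t0 _]; exact: hI.
  have {}tx T T0 := interconnection_trajectory hS1 hS2 hF (tx T T0).
  do 4 eexists; split=> [T T0|T T0|//].
    exact: (tx T T0).1.
  exact: (tx T T0).2.
- split; first exact: interconnection_monotone.
  exact: adjoint_interconnectB.
- move=> [_ m1] [_ m2]; split; first exact: interconnection_monotone.
  exact: interconnection_m_accretive.
- by move=> xbar; exact: interconnection_strongly_accretive.
- move=> xbar s1 s2 Mxbar.
  have sS := interconnection_strongly_accretive hS1 hS2 hF s1 s2.
  have [c c0 cP] := interconnection_exp_decay hS1 hS2 hF sS Mxbar.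
  exists 1, c; split => // x0 x sx t t0; rewrite mul1r.
  exact: cP.
Qed.
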